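(* There exists a finitely generated residually finite group that has solvable word problem but does not have computable finite quotients (CFQ).
   Context: Let $G$ be a group generated by a finite set $S$. A marked finite group is a pair $(F,f)$ with $F$ a finite group (given by its multiplication table, or equivalently a finite presentation) and $f:S\to F$ a function. $G$ has CFQ (computable finite quotients) if there is an algorithm which, given $(F,f)$, decides whether $f$ extends to a group homomorphism $\hat f:G\to F$ (i.e. $\hat f(s)=f(s)$ for all $s\in S$). This property does not depend on the choice of the finite generating set $S$. *)

(* Defs.v *)
From mathcomp Require Import all_boot all_fingroup.
Set Implicit Arguments. Unset Strict Implicit. Unset Printing Implicit Defensive.

Inductive rcode : Type :=
  | RZero : rcode
  | RSucc : rcode
  | RProj : nat -> rcode
  | RComp : rcode -> list rcode -> rcode
  | RPrim : rcode -> rcode -> rcode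
  | RMu   : rcode -> rcode.

Fixpoint opt_all (l : list (option nat)) : option (list nat) :=
  match l with
  | nil => Some nil
  | Some x :: l' => match opt_all l' with Some r => Some (x :: r) | None => None end
  | None :: _ => None
  end.

(* [reval k c v]: run code [c] on arguments [v] with fuel [k]; [None] means
   "not (yet) terminated". *)
Fixpoint reval (k : nat) (c : rcode) (v : list nat) {struct k} : option nat :=
  match k with
  | 0 => None
  | S k' =>
    match c with
    | RZero => Some 0
    | RSucc => match v with x :: _ => Some (S x) | nil => None end
    | RProj i => if i < size v then Some (nth 0 v i) else None
    | RComp f gs =>
        match opt_all (map (fun g => reval k' g v) gs) with
        | Some w => reval k' f w
        | None => None
        end
    | RPrim f g =>
        match v with
        | nil => None
        | x :: v' =>
          (fix pr (n : nat) : option nat :=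
             match n with
             | 0 => reval k' f v'
             | S n' => match pr n' with
                       | Some r => reval k' g (n' :: r :: v')
                       | None => None
                       end
             end) x
        end
    | RMu f =>
        (fix mu (y fuel : nat) : option nat :=
           match fuel with
           | 0 => None
           | S fu => match reval k' f (y :: v) with
                     | Some 0 => Some y
                     | Some _ => mu (S y) fu
                     | None => None
                     end
           end) 0 k'
    end
  end.

Definition computes (c : rcode) (h : nat -> nat) : Prop :=
  forall n, (exists k, reval k c [:: n] = Some (h n)) /\
            (forall k r, reval k c [:: n] = Some r -> r = h n).

Definition decidable_nat (P : nat -> Prop) : Prop :=
  exists (c : rcode) (h : nat -> nat), computes c h /\ (forall n, P n <-> h n <> 0).

Record fgGroup : Type := FgGroup {
  carrier : Type;
  gmul : carrier -> carrier -> carrier;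
  ginv : carrier -> carrier;
  gone : carrier;
  gmulA : forall x y z, gmul x (gmul y z) = gmul (gmul x y) z;
  gmul1 : forall x, gmul gone x = x;
  gmulV : forall x, gmul (ginv x) x = gone;
  ngen : nat;
  gen : nat -> carrier;   (* only gen 0, ..., gen (ngen - 1) are the generators *)
  gen_generates : forall x, exists w : seq (nat * bool),
      all (fun p => p.1 < ngen) w /\
      x = foldr (fun p acc => gmul (if p.2 then gen p.1 else ginv (gen p.1)) acc) gone w
}.

Definition word_val (G : fgGroup) (w : seq (nat * bool)) : carrier G :=
  foldr (fun p acc => gmul (if p.2 then gen G p.1 else ginv (gen G p.1)) acc) (gone G) w.

Definition is_word (G : fgGroup) (w : seq (nat * bool)) : bool :=
  all (fun p => p.1 < ngen G) w.

Definition residually_finite (G : fgGroup) : Prop :=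
  forall g : carrier G, g <> gone G ->
    exists (F : finGroupType) (phi : carrier G -> F),
      (forall x y, phi (gmul x y) = (phi x * phi y)%g) /\ phi g <> 1%g.

Definition solvable_WP (G : fgGroup) : Prop :=
  decidable_nat (fun m => exists w : seq (nat * bool),
                   pickle w = m /\ is_word G w /\ word_val G w = gone G).

(* A table [t] on {0, ..., m-1}, m = size t; product of a and b is t[a][b]. *)
Definition tmul (t : seq (seq nat)) (a b : nat) : nat := nth 0 (nth [::] t a) b.

Definition valid_table (t : seq (seq nat)) : Prop :=
  let m := size t in
  0 < m /\
  (forall a, a < m -> size (nth [::] t a) = m) /\
  (forall a b, a < m -> b < m -> tmul t a b < m) /\
  (forall a b c, a < m -> b < m -> c < m ->
      tmul t a (tmul t b c) = tmul t (tmul t a b) c) /\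
  (exists e, e < m /\ (forall a, a < m -> tmul t e a = a /\ tmul t a e = a) /\
             (forall a, a < m -> exists b, b < m /\ tmul t a b = e /\ tmul t b a = e)).

(* A marked finite group (F, f) with f : S -> F is given by a valid table [t]
   and the list [fl] of images of the generators (fl has length ngen G, entries < size t). *)
Definition valid_marking (G : fgGroup) (t : seq (seq nat)) (fl : seq nat) : Prop :=
  valid_table t /\ size fl = ngen G /\ all (fun a => a < size t) fl.

Definition extends_to_hom (G : fgGroup) (t : seq (seq nat)) (fl : seq nat) : Prop :=
  exists phi : carrier G -> nat,
    (forall x, phi x < size t) /\
    (forall x y, phi (gmul x y) = tmul t (phi x) (phi y)) /\
    (forall i, i < ngen G -> phi (gen G i) = nth 0 fl i).

(* CFQ: an algorithm decides, on (codes of) marked finite groups, whether the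
   marking extends to a homomorphism; its answer on invalid inputs is irrelevant. *)
Definition CFQ (G : fgGroup) : Prop :=
  exists (c : rcode) (h : nat -> nat), computes c h /\
    forall (t : seq (seq nat)) (fl : seq nat), valid_marking G t fl ->
      (extends_to_hom G t fl <-> h (pickle (t, fl)) <> 0).

(* Main.v *)
Require Import Defs.
From mathcomp Require Import all_boot all_fingroup all_algebra.
From Stdlib Require Import Classical ClassicalEpsilon FunctionalExtensionality.
Set Implicit Arguments. Unset Strict Implicit. Unset Printing Implicit Defensive.

Import GRing.Theory.

(** For [T : nat -> nat], let [G(T)] be the diagonal group generated by [t], [x],
    [y] acting on finite machines indexed by [(n, M)] with [M] a divisor of [T n]
    (any [M] if [T n = 0]).  A machine has a register in Z/M and a cyclic tape of
    [2 ^ n.+1] cells over Z/M with a head: [t] moves the head, [x] increments the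
    cell under it, and [y] adds to the register the cell at distance [2 ^ n] from
    it.  As [2 ^ n = 2 ^ k] modulo [2 ^ k.+1] only if [n = k], the commutator of
    [t ^ (2 ^ n) x t ^ (- 2 ^ n)] and [y] is visible on the machines of index [n]
    only, and its order is [T n] (infinite if [T n = 0]).  The group is residually
    finite by construction.  Whether a word is trivial depends on finitely many
    counts, and on congruences modulo [T n] for finitely many [n], so a decidable
    graph of [T] suffices for a solvable word problem.

    Now let [T n], for [n] the index of a program [c], be the least [p] encoding a
    proof that [c] accepts some marked finite group [Q] in which that commutator is
    nontrivial while [x ^ p = x]; let [T n = 0] if there is none.  The graph of [T]
    is decidable.  If [c] accepts such a [Q], then [Q] is not a quotient of [G(T)],
    since [x = x ^ p] and [t ^ (2 ^ n) x ^ p t ^ (- 2 ^ n)] commutes with [y] in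
    [G(T)].  Otherwise [c] rejects the action of [G(T)] on a machine of index [n].
    So no program decides the finite quotients of [G(T)]. *)

(** * Evaluation and its dependence on the fuel *)

Lemma opt_allP l w : opt_all l = Some w <-> l = map Some w.
Proof.
elim: l w => [|[x|] l IHl] [|y w] //=; split => //.
- by case: (opt_all l).
- by case E: (opt_all l) => [r|] // [<- <-]; congr (_ :: _); apply/IHl.
- by case=> <- /IHl ->.
Qed.

Lemma reval_mono k k' c v r :
  k <= k' -> reval k c v = Some r -> reval k' c v = Some r.
Proof.
elim: k k' c v r => // k IHk [|k'] // c v r; rewrite ltnS => le_kk'.
case: c => //= [f gs|f g|f].
- case E: (opt_all _) => [w|] // /(IHk _ _ _ _ le_kk') fw.
  suff -> : opt_all [seq reval k' g v | g <- gs] = Some w by [].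
  move/opt_allP: E => E; apply/opt_allP.
  elim: gs w E {fw} => [|g gs IHgs] [|x w] //= [gx gsw].
  by rewrite (IHk _ _ _ _ le_kk' gx) (IHgs w).
- case: v => // x v; elim: x r => [|x IHx] r; first exact: IHk.
  by case E: (_ x) => [s|] // /(IHk _ _ _ _ le_kk') gr; rewrite (IHx _ E).
(* The fuel also bounds the search of [RMu], so the two loops are compared from any starting point
   [y] and for any bounds [u <= u']. *)
- set mu := (X in X 0 k = Some r); set mu' := (X in X 0 k' = Some r).
  suff mono u u' y : u <= u' -> mu y u = Some r -> mu' y u' = Some r by exact: mono.
  elim: u u' y => // u IHu [|u'] // y le_uu' /=.
  case E: (reval k f (y :: v)) => [s|] //.
  by rewrite (IHk _ _ _ _ le_kk' E); case: s {E} => // s; apply: IHu.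
Qed.

Lemma reval_fun k k' c v r r' :
  reval k c v = Some r -> reval k' c v = Some r' -> r = r'.
Proof.
move=> /(reval_mono (leq_maxl k k')) E /(reval_mono (leq_maxr k k')).
by rewrite E => -[].
Qed.

(** * Total recursive functions and decidable predicates *)

(** One successful fuel pins down the value, because results agree across fuels by [reval_fun]. *)
Definition recfun (k : nat) (f : seq nat -> nat) : Prop :=
  exists c, forall v, size v = k -> exists fuel, reval fuel c v = Some (f v).

Definition recpred (k : nat) (P : seq nat -> Prop) : Prop :=
  exists f, recfun k f /\ forall v, size v = k -> (P v <-> f v <> 0).

Lemma recfun_ext k f g :
  (forall v, size v = k -> f v = g v) -> recfun k f -> recfun k g.
Proof. by move=> fg [c fc]; exists c => v vk; rewrite -fg //; apply: fc. Qed.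

Lemma recpred_ext k P Q :
  (forall v, size v = k -> (P v <-> Q v)) -> recpred k P -> recpred k Q.
Proof.
by move=> PQ [f [recf Pf]]; exists f; split=> // v vk; rewrite -PQ // Pf.
Qed.

Lemma recfun_comp m k f (gs : seq (seq nat -> nat)) :
    size gs = m -> recfun m f -> foldr (fun g P => recfun k g /\ P) True gs ->
  recfun k (fun v => f (map (fun g => g v) gs)).
Proof.
move=> sz_gs [c fc] recgs.
suff [cs csP] : exists cs, forall v, size v = k -> exists fuel,
    map (fun d => reval fuel d v) cs = map (fun g => Some (g v)) gs.
  exists (RComp c cs) => v vk; have [u Eu] := csP v vk.
  have [|u' Eu'] := fc (map (fun g => g v) gs); first by rewrite size_map.
  exists (maxn u u').+1 => /=.
  suff -> : opt_all [seq reval (maxn u u') g v | g <- cs] = Some [seq g v | g <- gs].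
    exact: reval_mono (leq_maxr _ _) Eu'.
  apply/opt_allP; rewrite -map_comp.
  elim: cs (gs) Eu {csP fc sz_gs recgs Eu'} => [|d cs IHcs] [|g hs] //= [Ed Ecs].
  by rewrite (IHcs hs) // (reval_mono (leq_maxl _ _) Ed).
elim: gs {sz_gs} recgs => [|g gs IHgs] /=; first by exists [::] => v _; exists 0.
move=> [[d dP] /IHgs[cs csP]]; exists (d :: cs) => v vk.
have [u Eu] := dP v vk; have [u' Eu'] := csP v vk.
exists (maxn u u') => /=; rewrite (reval_mono (leq_maxl _ _) Eu); congr (_ :: _).
elim: cs (gs) Eu' {csP IHgs} => [|e cs IHcs] [|h hs] //= [Ee Ecs].
by rewrite (IHcs hs) // (reval_mono (leq_maxr _ _) Ee).
Qed.

Lemma recfun_app1 k (f : nat -> nat) a :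
  recfun 1 (fun v => f (nth 0 v 0)) -> recfun k a -> recfun k (fun v => f (a v)).
Proof. by move=> recf reca; apply: (recfun_comp (gs := [:: a]) _ recf). Qed.

Lemma recfun_app2 k (f : nat -> nat -> nat) a b :
    recfun 2 (fun v => f (nth 0 v 0) (nth 0 v 1)) -> recfun k a -> recfun k b ->
  recfun k (fun v => f (a v) (b v)).
Proof. by move=> recf reca recb; apply: (recfun_comp (gs := [:: a; b]) _ recf). Qed.

Lemma recpred_app1 k (P : nat -> Prop) a :
  recpred 1 (fun v => P (nth 0 v 0)) -> recfun k a -> recpred k (fun v => P (a v)).
Proof.
move=> [f [recf Pf]] reca; exists (fun v => f [:: a v]).
by split=> [|v _]; [exact: (recfun_comp (gs := [:: a]) _ recf) | exact: (Pf [:: a v])].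
Qed.

Lemma recpred_app2 k (P : nat -> nat -> Prop) a b :
    recpred 2 (fun v => P (nth 0 v 0) (nth 0 v 1)) -> recfun k a -> recfun k b ->
  recpred k (fun v => P (a v) (b v)).
Proof.
move=> [f [recf Pf]] reca recb; exists (fun v => f [:: a v; b v]).
split=> [|v _]; first exact: (recfun_comp (gs := [:: a; b]) _ recf).
exact: (Pf [:: a v; b v]).
Qed.

Lemma recpred_app3 k (P : nat -> nat -> nat -> Prop) a b c :
    recpred 3 (fun v => P (nth 0 v 0) (nth 0 v 1) (nth 0 v 2)) ->
    recfun k a -> recfun k b -> recfun k c ->
  recpred k (fun v => P (a v) (b v) (c v)).
Proof.
move=> [f [recf Pf]] reca recb recc; exists (fun v => f [:: a v; b v; c v]).
split=> [|v _]; first exact: (recfun_comp (gs := [:: a; b; c]) _ recf).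
exact: (Pf [:: a v; b v; c v]).
Qed.

Lemma recfun_var k i : i < k -> recfun k (fun v => nth 0 v i).
Proof. by move=> ltik; exists (RProj i) => v vk; exists 1; rewrite /= vk ltik. Qed.

Lemma recfun_behead k (g : seq nat -> seq nat) i :
  recfun k (fun v => nth 0 (g v) i.+1) -> recfun k (fun v => nth 0 (behead (g v)) i).
Proof. by apply: recfun_ext => v _; rewrite nth_behead. Qed.

Lemma recfun_succ k a : recfun k a -> recfun k (fun v => (a v).+1).
Proof.
by apply: recfun_app1; exists RSucc => -[|x []] // _; exists 1.
Qed.

Lemma recfun_cst k n : recfun k (fun _ => n).
Proof.
elim: n => [|n IHn]; first by exists RZero => v _; exists 1.
exact: recfun_succ.
Qed.

Lemma recfun_iteri k n b (s : nat -> nat -> seq nat -> nat) :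
    recfun k n -> recfun k b ->
    recfun k.+2 (fun v => s (nth 0 v 0) (nth 0 v 1) (behead (behead v))) ->
  recfun k (fun v => iteri (n v) (fun i r => s i r v) (b v)).
Proof.
move=> recn [cb cbP] [cs csP].
have recp : recfun k.+1 (fun v => iteri (nth 0 v 0) (fun i r => s i r (behead v))
                                    (b (behead v))).
  exists (RPrim cb cs) => -[|x v] // [vk] /=.
  suff [fuel E] : exists fuel, reval fuel (RPrim cb cs) (x :: v)
                   = Some (iteri x (fun i r => s i r v) (b v)) by exists fuel.
  elim: x => [|x [fuel E]]; first by have [u Eu] := cbP v vk; exists u.+1.
  have [|u Eu] := csP (x :: iteri x (fun i r => s i r v) (b v) :: v).
    by rewrite /= vk.
  exists (maxn fuel u).+1.
  have := reval_mono (leqW (leq_maxl fuel u)) E.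
  rewrite /= => ->; exact: reval_mono (leq_maxr _ _) Eu.
(* The recursion program expects its counter in front of the parameters, so it is composed with [n]
   and the [k] projections. *)
pose gs := n :: mkseq (fun i v => nth 0 v i) k.
apply: recfun_ext (recfun_comp (gs := gs) _ recp _) => [v vk||] /=.
- suff -> : [seq g v | g <- mkseq (fun i v => nth 0 v i) k] = v by [].
  by rewrite -map_comp -[in RHS](mkseq_nth 0 v) vk.
- by rewrite size_mkseq.
- split=> //.
  have : forall i, i \in iota 0 k -> i < k by move=> i; rewrite mem_iota.
  rewrite /mkseq; elim: (iota 0 k) => //= i l IHl lek; split.
    by apply/recfun_var/lek/mem_head.
  by apply: IHl => j jl; apply: lek; rewrite inE jl orbT.
Qed.

Lemma recfun_add k a b : recfun k a -> recfun k b -> recfun k (fun v => a v + b v).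
Proof.
move=> reca recb.
apply: recfun_ext (recfun_iteri (s := fun _ r _ => r.+1) reca recb _) => [v _|].
  by elim: (a v) => //= n ->.
exact/recfun_succ/recfun_var.
Qed.

Lemma recfun_mul k a b : recfun k a -> recfun k b -> recfun k (fun v => a v * b v).
Proof.
apply: recfun_app2.
apply: recfun_ext (recfun_iteri (n := fun v => nth 0 v 0) (b := fun v => 0)
  (s := fun _ r v => r + nth 0 v 1) _ _ _) => [v _|||].
- by elim: (nth 0 v 0) => //= n ->; rewrite mulSnr.
- exact: recfun_var.
- exact: recfun_cst.
- by apply: recfun_add; [exact: recfun_var | do 2!apply: recfun_behead; exact: recfun_var].
Qed.

Lemma recfun_pred k a : recfun k a -> recfun k (fun v => (a v).-1).
Proof.
apply: recfun_app1.
apply: recfun_ext (recfun_iteri (n := fun v => nth 0 v 0) (b := fun v => 0)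
  (s := fun i _ v => i) _ _ _) => [v _|||].
- by case: (nth 0 v 0).
- exact: recfun_var.
- exact: recfun_cst.
- exact: recfun_var.
Qed.

Lemma recfun_sub k a b : recfun k a -> recfun k b -> recfun k (fun v => a v - b v).
Proof.
move=> reca recb.
apply: recfun_ext (recfun_iteri (s := fun _ r _ => r.-1) recb reca _) => [v _|].
  by elim: (b v) => /= [|n ->]; rewrite ?subn0 // subnS.
exact/recfun_pred/recfun_var.
Qed.

Lemma recfun_exp2 k a : recfun k a -> recfun k (fun v => 2 ^ a v).
Proof.
move=> reca; apply: recfun_ext (recfun_iteri (s := fun _ r _ => r + r) reca
  (recfun_cst k 1) _) => [v _|].
  by elim: (a v) => //= n ->; rewrite expnS mul2n addnn.
by apply: recfun_add; apply: recfun_var.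
Qed.

Lemma recfun_sum k n (F : nat -> seq nat -> nat) :
    recfun k n -> recfun k.+1 (fun v => F (nth 0 v 0) (behead v)) ->
  recfun k (fun v => \sum_(0 <= i < n v) F i v).
Proof.
move=> recn recF.
apply: recfun_ext (recfun_iteri (s := fun i r v => r + F i v) recn
  (recfun_cst k 0) _) => [v _|].
  by elim: (n v) => [|m /= ->]; [rewrite big_geq | rewrite big_nat_recr].
apply: recfun_add; first exact: recfun_var.
(* The step receives the index, the partial sum and the parameters; these projections drop the
   partial sum before [F] is called. *)
pose gs := (fun v => nth 0 v 0) :: mkseq (fun i v => nth 0 v i.+2) k.
apply: recfun_ext (recfun_comp (gs := gs) _ recF _) => [v vk||] /=.
- suff -> : [seq g v | g <- mkseq (fun i v => nth 0 v i.+2) k] = behead (behead v) by [].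
  rewrite -map_comp -[in RHS](mkseq_nth 0 (behead (behead v))) !size_behead vk /=.
  by apply: eq_map => i /=; rewrite !nth_behead.
- by rewrite size_mkseq.
- split; first exact: recfun_var.
  have : forall i, i \in iota 0 k -> i < k by move=> i; rewrite mem_iota.
  rewrite /mkseq; elim: (iota 0 k) => //= i l IHl lek; split.
    by apply/recfun_var; rewrite !ltnS lek ?mem_head.
  by apply: IHl => j jl; apply: lek; rewrite inE jl orbT.
Qed.

Lemma recpred_lt k a b : recfun k a -> recfun k b -> recpred k (fun v => a v < b v).
Proof.
move=> reca recb; exists (fun v => b v - a v).
by split=> [|v _]; [exact: recfun_sub | rewrite -subn_gt0 lt0n; split=> /eqP].
Qed.

Lemma recpred_le k a b : recfun k a -> recfun k b -> recpred k (fun v => a v <= b v).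
Proof.
move=> reca /recfun_succ recb; apply: recpred_ext (recpred_lt reca recb) => v _.
by rewrite ltnS.
Qed.

Lemma recpred_and k P Q :
  recpred k P -> recpred k Q -> recpred k (fun v => P v /\ Q v).
Proof.
move=> [f [recf Pf]] [g [recg Qg]]; exists (fun v => f v * g v).
split=> [|v vk]; first exact: recfun_mul.
rewrite Pf // Qg //; split=> [[/eqP/negPf f0 /eqP/negPf g0] /eqP|/eqP].
  by rewrite muln_eq0 f0 g0.
by rewrite muln_eq0 negb_or => /andP[/eqP f0 /eqP g0].
Qed.

Lemma recpred_or k P Q :
  recpred k P -> recpred k Q -> recpred k (fun v => P v \/ Q v).
Proof.
move=> [f [recf Pf]] [g [recg Qg]]; exists (fun v => f v + g v).
split=> [|v vk]; first exact: recfun_add.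
by rewrite Pf // Qg //; case: (f v) (g v) => [|x] [|y]; split=> //; [case|right|left|left].
Qed.

Lemma recpred_not k P : recpred k P -> recpred k (fun v => ~ P v).
Proof.
move=> [f [recf Pf]]; exists (fun v => 1 - f v).
split=> [|v vk]; first exact: recfun_sub (recfun_cst _ _) recf.
by rewrite Pf //; case: (f v) => [|x]; split=> H E; try exact: E; apply: H.
Qed.

Lemma recpred_imp k (P Q : seq nat -> Prop) :
  recpred k P -> recpred k Q -> recpred k (fun v => P v -> Q v).
Proof.
move=> recP recQ; apply: recpred_ext (recpred_or (recpred_not recP) recQ) => v vk.
by case: (classic (P v)); tauto.
Qed.

Lemma recpred_eq k a b : recfun k a -> recfun k b -> recpred k (fun v => a v = b v).
Proof.
move=> reca recb.
apply: recpred_ext (recpred_and (recpred_le reca recb) (recpred_le recb reca)) => v _.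
by split=> [[leab leba]|->] //; apply/eqP; rewrite eqn_leq leab.
Qed.

(** Sum the characteristic values over the bounded range: the sum is nonzero exactly when some term
    is. *)
Lemma recpred_ex k n (P : nat -> seq nat -> Prop) :
    recfun k n -> recpred k.+1 (fun v => P (nth 0 v 0) (behead v)) ->
  recpred k (fun v => exists y, y < n v /\ P y v).
Proof.
move=> recn [f [recf Pf]]; exists (fun v => \sum_(0 <= y < n v) f (y :: v)).
split.
  apply: (recfun_sum (F := fun y v => f (y :: v)) recn).
  by apply: recfun_ext recf => -[|x v].
move=> v vk; rewrite big_mkord; split=> [[y [lty Py]] /eqP|/eqP].
  rewrite sum_nat_eq0 => /forallP/(_ (Ordinal lty))/eqP.
  by apply/Pf => //=; rewrite vk.
rewrite sum_nat_eq0 => /forallPn[y /eqP fy]; exists y; split=> //.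
by apply/(Pf (val y :: v)) => //=; rewrite vk.
Qed.

Lemma recpred_all k n (P : nat -> seq nat -> Prop) :
    recfun k n -> recpred k.+1 (fun v => P (nth 0 v 0) (behead v)) ->
  recpred k (fun v => forall y, y < n v -> P y v).
Proof.
move=> recn /recpred_not recP.
apply: recpred_ext (recpred_not (recpred_ex (P := fun y v => ~ P y v) recn recP)) => v _.
split=> [nex y lty|all [y [lty nPy]]]; last exact: nPy (all y lty).
by apply: NNPP => nPy; apply: nex; exists y.
Qed.

Lemma recfun_bool k (b : seq nat -> bool) :
  recpred k (fun v => b v) -> recfun k (fun v => b v : nat).
Proof.
move=> [f [recf bf]].
apply: recfun_ext (recfun_sub (recfun_cst k 1) (recfun_sub (recfun_cst k 1) recf)).
move=> v vk; have [] := bf v vk; case: (b v) (f v) => [] [|x] // H1 H2.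
- by case: (H1 isT).
- by have := H2 (fun e => ltac:(discriminate e)).
Qed.

(** The value is the sum of [y * (y == f v)] over [y <= b v]. This serves to invert recursive
    functions, such as the coding of sequences. *)
Lemma recfun_graph k b f :
    recfun k b -> recpred k.+1 (fun v => nth 0 v 0 = f (behead v)) ->
    (forall v, f v <= b v) ->
  recfun k f.
Proof.
move=> recb recf lefb.
apply: recfun_ext (recfun_sum (F := fun y v => y * (y == f v)) (recfun_succ recb) _).
  move=> v _; have ltf : f v < (b v).+1 by rewrite ltnS.
  rewrite big_mkord (bigD1 (Ordinal ltf)) //= eqxx muln1 big1 ?addn0 // => y.
  by rewrite -val_eqE /= => /negPf->; rewrite muln0.
apply: recfun_mul; first exact: recfun_var.
by apply: recfun_bool; apply: recpred_ext recf => v _; split=> /eqP.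
Qed.

Lemma recpred_andb k (b c : seq nat -> bool) :
  recpred k (fun v => b v) -> recpred k (fun v => c v) -> recpred k (fun v => b v && c v).
Proof.
by move=> recb recc; apply: recpred_ext (recpred_and recb recc) => v _; split=> /andP.
Qed.

Lemma recpred_eqb k a b : recfun k a -> recfun k b -> recpred k (fun v => a v == b v).
Proof.
by move=> reca recb; apply: recpred_ext (recpred_eq reca recb) => v _; split=> /eqP.
Qed.

(* Syntax-directed search: [rec_auto] reads a bounded arithmetical formula and applies one closure
   lemma per connective. Constants are opaque, so a definition is either unfolded by hand or given
   its own closure lemma. *)
Create HintDb recdb discriminated.
#[local] Hint Constants Opaque : recdb.
#[local] Hint Resolve recfun_behead recfun_succ recfun_cst recfun_iteri recfun_add
  recfun_mul recfun_pred recfun_sub recfun_exp2 recfun_sum recfun_bool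
  recpred_lt recpred_le recpred_and recpred_or recpred_not recpred_imp
  recpred_eq recpred_ex recpred_all recpred_andb recpred_eqb : recdb.
#[local] Hint Extern 0 (recfun _ (fun v => nth 0 v _)) =>
  (apply: recfun_var; reflexivity) : recdb.
Ltac rec_auto := solve [auto 100 with recdb nocore].

(** The congruence amounts to a bounded multiplier. Modulus 0 means equality, [modn] by 0 being the
    identity; this case matters because [T n] may be 0. *)
Lemma recpred_eqmod k a b p : recfun k a -> recfun k b -> recfun k p ->
  recpred k (fun v => a v = b v %[mod p v]).
Proof.
apply: (recpred_app3 (P := fun a b p => a = b %[mod p])).
apply: (recpred_ext (P := fun v => exists m, m < (nth 0 v 0 + nth 0 v 1).+1 /\
   (nth 0 v 0 = nth 0 v 1 + m * nth 0 v 2 \/ nth 0 v 1 = nth 0 v 0 + m * nth 0 v 2)));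
  last by rec_auto.
move=> v _; move: (nth 0 v 0) (nth 0 v 1) (nth 0 v 2) => {v a b p} x y p.
split=> [[m [_ [->|->]]]|].
- by rewrite addnC modnMDl.
- by rewrite addnC modnMDl.
wlog lexy : x y / x <= y.
  move=> IH; case/orP: (leq_total x y) => lexy E; first exact: IH.
  have [m [ltm H]] := IH _ _ lexy (esym E).
  by exists m; rewrite addnC; split=> //; case: H; [right|left].
move/eqP; rewrite eq_sym eqn_mod_dvd // => /dvdnP[m Em].
case: (posnP p) => [p0|p0].
  exists 0; split=> //; right; move/eqP: Em.
  by rewrite p0 muln0 addn0 subn_eq0 => leyx; apply/eqP; rewrite eqn_leq leyx.
exists m; split; last by right; rewrite -Em subnKC.
rewrite ltnS (leq_trans _ (leq_addl _ _)) // (leq_trans (leq_pmulr m p0)) //.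
by rewrite -Em leq_subr.
Qed.
#[local] Hint Resolve recpred_eqmod : recdb.

(** * Arithmetic of codes of sequences *)

Local Notation code := CodeSeq.code.
Local Notation decode := CodeSeq.decode.
#[local] Arguments CodeSeq.code : simpl never.
#[local] Arguments CodeSeq.decode : simpl never.

Definition chead (m : nat) := nth 0 (decode m) 0.
Definition cbehead (m : nat) := code (behead (decode m)).
Definition cnth (m i : nat) := nth 0 (decode m) i.
Definition csize (m : nat) := size (decode m).

Lemma code_cons x s : code (x :: s) = 2 ^ x * (code s + code s).+1.
Proof. by rewrite addnn. Qed.

Lemma code_inj : injective code.
Proof. exact: can_inj CodeSeq.codeK. Qed.

Lemma cnthE s i : cnth (code s) i = nth 0 s i.
Proof. by rewrite /cnth CodeSeq.codeK. Qed.

Lemma csizeE s : csize (code s) = size s.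
Proof. by rewrite /csize CodeSeq.codeK. Qed.

Lemma ltn_mem_code x s : x \in s -> x < code s.
Proof. by move=> xs; apply: (allP (CodeSeq.ltn_code s)). Qed.

Lemma cnth_le m i : cnth m i <= m.
Proof.
rewrite /cnth; have [lti|lei] := ltnP i (size (decode m)); last by rewrite nth_default.
by rewrite -[leqRHS]CodeSeq.decodeK ltnW // ltn_mem_code // mem_nth.
Qed.

Lemma code_behead_le s : code (behead s) <= code s.
Proof.
case: s => [|x s] //; rewrite [behead _]/= code_cons.
rewrite (leq_trans _ (leq_pmull _ _)) ?expn_gt0 // ltnW // ltnS.
exact: leq_addr.
Qed.

Lemma recfun_cons k a b :
  recfun k a -> recfun k b -> recfun k (fun v => code (a v :: decode (b v))).
Proof.
apply: (recfun_app2 (f := fun a b => code (a :: decode b))).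
apply: (recfun_ext (f := fun v => 2 ^ nth 0 v 0 * (nth 0 v 1 + nth 0 v 1).+1));
  last by rec_auto.
by move=> v _; rewrite code_cons CodeSeq.decodeK.
Qed.

Lemma recfun_seq1 k a : recfun k a -> recfun k (fun v => code [:: a v]).
Proof. by move=> reca; apply: (recfun_cons reca (recfun_cst k 0)). Qed.

Lemma recfun_seq3 k a b c : recfun k a -> recfun k b -> recfun k c ->
  recfun k (fun v => code [:: a v; b v; c v]).
Proof.
move=> reca recb recc.
apply: recfun_ext (recfun_cons reca (recfun_cons recb (recfun_cons recc (recfun_cst k 0)))).
by move=> v _; rewrite !CodeSeq.codeK.
Qed.
#[local] Hint Resolve recfun_cons recfun_seq1 recfun_seq3 : recdb.

(** A nonzero code factors uniquely as [2 ^ x * (l + l).+1], with [x] the head and [l] the code of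
    the tail, so the graph is a bounded formula and [recfun_graph] applies with the code itself as
    bound. The tail is treated likewise. *)
Lemma recfun_chead k a : recfun k a -> recfun k (fun v => chead (a v)).
Proof.
apply: recfun_app1; apply: (recfun_graph (recfun_var (ltn0Sn 0))); last first.
  by move=> v; apply: cnth_le.
apply: (recpred_ext (P := fun v => (nth 0 v 1 = 0 /\ nth 0 v 0 = 0) \/
  exists l, l < (nth 0 v 1).+1 /\ nth 0 v 1 = 2 ^ nth 0 v 0 * (l + l).+1));
  last by rec_auto.
move=> [|y v] // _; rewrite /= /chead.
have [s ->] : exists s, nth 0 v 0 = code s.
  by exists (decode (nth 0 v 0)); rewrite CodeSeq.decodeK.
rewrite CodeSeq.codeK; case: s => [|x s]; split.
- by case=> [[]//|[l [_ /esym/eqP]]]; rewrite muln_eq0 expn_eq0.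
- by left.
- case=> [[/eqP]|[l [_]]]; first by rewrite code_cons muln_eq0 expn_eq0.
  by rewrite -[l]CodeSeq.decodeK -code_cons => /code_inj[].
- move=> ->; right; exists (code s); split=> //; last exact: code_cons.
  by rewrite ltnS (code_behead_le (x :: s)).
Qed.

Lemma recfun_cbehead k a : recfun k a -> recfun k (fun v => cbehead (a v)).
Proof.
apply: recfun_app1; apply: (recfun_graph (recfun_var (ltn0Sn 0))); last first.
  by move=> v; rewrite -[leqRHS]CodeSeq.decodeK; apply: code_behead_le.
apply: (recpred_ext (P := fun v => (nth 0 v 1 = 0 /\ nth 0 v 0 = 0) \/
  exists x, x < (nth 0 v 1).+1 /\ nth 0 v 1 = 2 ^ x * (nth 0 v 0 + nth 0 v 0).+1));
  last by rec_auto.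
move=> [|y v] // _; rewrite /= /cbehead.
have [s ->] : exists s, nth 0 v 0 = code s.
  by exists (decode (nth 0 v 0)); rewrite CodeSeq.decodeK.
rewrite CodeSeq.codeK; case: s => [|x s]; split.
- by case=> [[]//|[l [_ /esym/eqP]]]; rewrite muln_eq0 expn_eq0.
- by left.
- case=> [[/eqP]|[z [_]]]; first by rewrite code_cons muln_eq0 expn_eq0.
  by rewrite -[y]CodeSeq.decodeK -code_cons => /code_inj[_ ->].
- move=> ->; right; exists x; split; last exact: code_cons.
  by rewrite ltnS ltnW // ltn_mem_code // mem_head.
Qed.
#[local] Hint Resolve recfun_chead recfun_cbehead : recdb.

Lemma iteri_cbehead i s : iteri i (fun _ => cbehead) (code s) = code (drop i s).
Proof.
elim: i => [|i /= ->]; first by rewrite drop0.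
by rewrite /cbehead CodeSeq.codeK -drop1 drop_drop addnC addn1.
Qed.

Lemma recfun_cnth k a b :
  recfun k a -> recfun k b -> recfun k (fun v => cnth (a v) (b v)).
Proof.
apply: recfun_app2.
apply: (recfun_ext (f := fun v =>
  chead (iteri (nth 0 v 1) (fun _ r => cbehead r) (nth 0 v 0)))); last by rec_auto.
move=> v _; rewrite -[nth 0 v 0]CodeSeq.decodeK iteri_cbehead /chead cnthE.
by rewrite CodeSeq.codeK nth_drop addn0.
Qed.

Lemma csize_le m : csize m <= m.
Proof.
rewrite -{2}[m]CodeSeq.decodeK /csize; elim: (decode m) => [|x s IHs] //.
rewrite code_cons /= (leq_trans _ (leq_pmull _ _)) ?expn_gt0 // ltnS.
exact: leq_trans IHs (leq_addr _ _).
Qed.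

(** The size is the least number of tails to take before reaching 0, the code of the empty
    sequence. *)
Lemma recfun_csize k a : recfun k a -> recfun k (fun v => csize (a v)).
Proof.
apply: recfun_app1; apply: (recfun_graph (recfun_var (ltn0Sn 0))); last first.
  by move=> v; apply: csize_le.
apply: (recpred_ext (P := fun v =>
  iteri (nth 0 v 0) (fun _ r => cbehead r) (nth 0 v 1) = 0 /\
  forall y, y < nth 0 v 0 -> iteri y (fun _ r => cbehead r) (nth 0 v 1) <> 0));
  last by rec_auto.
move=> [|y v] // _; rewrite /=.
rewrite -[nth 0 v 0]CodeSeq.decodeK csizeE; move: (decode _) => s.
have drop0P i : iteri i (fun _ => cbehead) (code s) = 0 <-> size s <= i.
  rewrite iteri_cbehead; split=> [/(code_inj (x2 := [::]))/eqP|le_si].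
    by rewrite -size_eq0 size_drop.
  by rewrite drop_oversize.
split=> [[/drop0P le_sy all]|->]; last first.
  by split=> [|i lti /drop0P]; [exact/drop0P | rewrite leqNgt lti].
apply/eqP; rewrite eqn_leq le_sy andbT leqNgt.
by apply/negP => /all; apply; apply/drop0P.
Qed.
#[local] Hint Resolve recfun_cnth recfun_csize : recdb.

(** * Certificates of evaluation *)

Fixpoint rcode_code (c : rcode) : nat :=
  match c with
  | RZero => code [:: 0]
  | RSucc => code [:: 1]
  | RProj i => code [:: 2; i]
  | RComp f gs => code [:: 3; rcode_code f; code (map rcode_code gs)]
  | RPrim f g => code [:: 4; rcode_code f; rcode_code g]
  | RMu f => code [:: 5; rcode_code f]
  end.

(* The judgment "the program coded by [e], run on the arguments coded by [v],
   returns [r]" is the number [code [:: e; v; r]].  It is justified by a set [D]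
   of judgments if it follows by one evaluation rule from elements of [D]; [b]
   bounds the existential witnesses. *)
Definition justified (b : nat) (D : seq nat) (e v r : nat) : Prop :=
  [\/ cnth e 0 = 0 /\ r = 0,
      cnth e 0 = 1 /\ (0 < csize v /\ r = (cnth v 0).+1),
      cnth e 0 = 2 /\ (cnth e 1 < csize v /\ r = cnth v (cnth e 1)) |
      cnth e 0 = 3 /\ exists w, w < b /\ (csize w = csize (cnth e 2) /\
        ((forall i, i < csize w -> code [:: cnth (cnth e 2) i; v; cnth w i] \in D) /\
         code [:: cnth e 1; w; r] \in D))] \/
  (cnth e 0 = 4 /\ (0 < csize v /\
        ((cnth v 0 = 0 /\ code [:: cnth e 1; cbehead v; r] \in D) \/
         exists s, s < b /\ (0 < cnth v 0 /\
          (code [:: e; code ((cnth v 0).-1 :: decode (cbehead v)); s] \in D /\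
           code [:: cnth e 2; code ((cnth v 0).-1 ::
             decode (code (s :: decode (cbehead v)))); r] \in D)))) \/
   cnth e 0 = 5 /\ (code [:: cnth e 1; code (r :: decode v); 0] \in D /\
        forall y, y < r -> exists s, s < b /\
          code [:: cnth e 1; code (y :: decode v); s.+1] \in D)).

Definition certificate (b : nat) (D : seq nat) : Prop :=
  forall J, J \in D -> justified b D (cnth J 0) (cnth J 1) (cnth J 2).

Lemma reval_comp k f gs v r : reval k.+1 (RComp f gs) v = Some r ->
  exists2 w, map (fun g => reval k g v) gs = map Some w & reval k f w = Some r.
Proof. by rewrite /=; case E: (opt_all _) => [w|] // fw; exists w; first exact/opt_allP. Qed.

Lemma reval_mu k f v r : reval k.+1 (RMu f) v = Some r ->
  reval k f (r :: v) = Some 0 /\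
  forall y, y < r -> exists s, reval k f (y :: v) = Some s.+1.
Proof.
rewrite /=; set mu := (X in X 0 k = Some r).
suff muP u y : mu y u = Some r -> reval k f (r :: v) = Some 0 /\
    forall z, y <= z < r -> exists s, reval k f (z :: v) = Some s.+1.
  by case/muP=> fr fz; split=> // y lty; apply: fz.
elim: u y => // u IHu y /=.
case E: (reval k f (y :: v)) => [[|s]|] //.
  by case=> <-; split=> // z; rewrite ltnNge andbN.
case/IHu=> fr fz; split=> // z; case: (ltngtP y z) => //= [ltyz ltzr | <- _].
  by apply: fz; rewrite ltyz.
by exists s.
Qed.

Lemma justified_sub b b' (D D' : seq nat) e v r : b <= b' -> {subset D <= D'} ->
  justified b D e v r -> justified b' D' e v r.
Proof.
move=> leb sub.
have ltb n : n < b -> n < b' by move=> ltn; apply: leq_trans leb.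
case=> [[H|H|H|[? [w [/ltb ltw [sw [Dg Df]]]]]]|[[? [v0 H]]|[? [Df Dy]]]].
- by left; constructor 1.
- by left; constructor 2.
- by left; constructor 3.
- left; constructor 4; split=> //; exists w; split=> //; split=> //.
  by split=> [i /Dg/sub|]; [|exact: sub].
- right; left; split=> //; split=> //.
  case: H => [[? /sub ?]|[s [/ltb lts [? [/sub ? /sub ?]]]]]; first by left.
  by right; exists s.
- right; right; split=> //; split; first exact: sub.
  by move=> y /Dy[s [/ltb ? /sub ?]]; exists s.
Qed.

Definition derivable (J : nat) : Prop :=
  exists b D, certificate b D /\ J \in D.

(** Certificates are closed under union, because [justified] is monotone in the bound and in the
    set; the new judgment is put on top of the certificates of its premises. *)
Lemma derivable_justified b Ps e v r :
    (forall J, J \in Ps -> derivable J) -> justified b Ps e v r ->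
  derivable (code [:: e; v; r]).
Proof.
move=> derPs just.
have [b1 [D [certD sub]]] : exists b1 D, certificate b1 D /\ {subset Ps <= D}.
  elim: Ps derPs {just} => [|J Ps IHPs] derPs; first by exists 0, [::].
  have [|b1 [D1 [cert1 sub1]]] := IHPs.
    by move=> K KPs; apply: derPs; rewrite inE KPs orbT.
  have [b2 [D2 [cert2 JD2]]] := derPs J (mem_head _ _).
  exists (maxn b1 b2), (D1 ++ D2); split=> [K|K].
    rewrite mem_cat => /orP[/cert1|/cert2]; apply: justified_sub => //.
    - exact: leq_maxl.
    - by move=> L; rewrite mem_cat => ->.
    - exact: leq_maxr.
    - by move=> L; rewrite mem_cat orbC => ->.
  by rewrite inE mem_cat => /predU1P[->|/sub1->]; rewrite ?JD2 ?orbT.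
exists (maxn b b1), (code [:: e; v; r] :: D); split; last exact: mem_head.
move=> K; rewrite inE => /predU1P[->|/certD].
  rewrite !cnthE; apply: justified_sub just; first exact: leq_maxl.
  by move=> L /sub; rewrite inE orbC => ->.
by apply: justified_sub => [|L]; rewrite ?leq_maxr // inE orbC => ->.
Qed.

(** Completeness of certificates: subevaluations run on less fuel, so they are derivable by
    induction. Primitive recursion keeps its fuel while the counter drops, hence an inner induction
    on the counter. *)
Lemma reval_derivable k c v r :
  reval k c v = Some r -> derivable (code [:: rcode_code c; code v; r]).
Proof.
elim: k c v r => // k IHk c v r; case: c => [||i|f gs|f g|f] E.
- apply: (derivable_justified (b := 0) (Ps := [::])) => //.
  by left; constructor 1; rewrite cnthE; case: E.
- apply: (derivable_justified (b := 0) (Ps := [::])) => //.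
  left; constructor 2; rewrite !cnthE csizeE.
  by move: E => /=; case: v => // x v [<-].
- apply: (derivable_justified (b := 0) (Ps := [::])) => //.
  left; constructor 3; rewrite !cnthE csizeE /=.
  by move: E => /=; case: ifP => // _ [<-].
- have [w gsw fw] := reval_comp E.
  have szw : size w = size gs by rewrite -[LHS](size_map Some) -gsw size_map.
  pose P i := code [:: nth 0 (map rcode_code gs) i; code v; nth 0 w i].
  pose Ps := code [:: rcode_code f; code w; r] :: mkseq P (size w).
  apply: (derivable_justified (b := (code w).+1) (Ps := Ps)).
    move=> J; rewrite inE => /predU1P[->|/mapP[i]]; first exact: IHk.
    rewrite mem_iota add0n => /= lti ->; rewrite /P (nth_map RZero) -?szw //.
    apply: IHk; have := congr1 (fun s => nth None s i) gsw.
    by rewrite (nth_map RZero) -?szw // (nth_map 0).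
  left; constructor 4; rewrite !cnthE; split=> //; exists (code w).
  rewrite /= !csizeE size_map; split=> //; split=> //; split; last exact: mem_head.
  move=> i lti; rewrite !cnthE inE; apply/orP; right.
  by apply/mapP; exists i; rewrite ?mem_iota.
- case: v E => // x v; elim: x r => [|x IHx] r E.
    apply: (derivable_justified (b := 0) (Ps := [:: code [:: rcode_code f; code v; r]])).
      by move=> J; rewrite inE => /eqP->; apply: IHk.
    right; left; rewrite !cnthE csizeE /cbehead !CodeSeq.codeK; split=> //; split=> //.
    by left; rewrite mem_head.
  move: E; rewrite /=; case E: (_ x) => [s|] // Eg.
  pose Ps := [:: code [:: rcode_code (RPrim f g); code (x :: v); s];
                 code [:: rcode_code g; code [:: x, s & v]; r]].
  apply: (derivable_justified (b := s.+1) (Ps := Ps)).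
    move=> J; rewrite !inE => /orP[]/eqP->; first exact: IHx.
    exact: IHk.
  right; left; rewrite !cnthE csizeE /cbehead !CodeSeq.codeK; split=> //; split=> //.
  right; exists s; split=> //; split=> //.
  by split; rewrite /Ps ?CodeSeq.codeK /= !inE eqxx ?orbT.
- have [fr fy] := reval_mu E.
  (* The values at all [y < r] need one common bound, accumulated by induction on [r]. *)
  have [b [Ps [derPs PsP]]] : exists b (Ps : seq nat), (forall J, J \in Ps -> derivable J) /\
      forall y, y < r -> exists s, s < b /\
        code [:: rcode_code f; code (y :: v); s.+1] \in Ps.
    elim: r fy {fr E} => [|r IHr] fy; first by exists 0, [::].
    have [|b [Ps [derPs PsP]]] := IHr; first by move=> y lty; apply/fy/ltnW.
    have [s Es] := fy r (leqnn _).
    exists (maxn b s.+1), (code [:: rcode_code f; code (r :: v); s.+1] :: Ps).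
    split=> [J|y]; first by rewrite inE => /predU1P[->|/derPs//]; apply: IHk.
    rewrite ltnS leq_eqVlt => /predU1P[->|/PsP[s' [lts' mem]]].
      by exists s; rewrite leq_maxr mem_head.
    by exists s'; rewrite leq_max lts' inE mem orbT.
  apply: (derivable_justified (b := b)
           (Ps := code [:: rcode_code f; code (r :: v); 0] :: Ps)).
    by move=> J; rewrite inE => /predU1P[->|/derPs//]; apply: IHk.
  right; right; rewrite !cnthE CodeSeq.codeK mem_head; split=> //; split=> // y.
  by case/PsP=> s [lts mem]; exists s; rewrite inE mem orbT.
Qed.

(* A finite self-justifying set of judgments is sound, since following the
   justifications inside a finite set terminates; here this is seen from the
   fuel of a terminating evaluation. *)
Lemma certificate_sound b D k c v r s : certificate b D ->
  reval k c v = Some r -> code [:: rcode_code c; code v; s] \in D -> s = r.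
Proof.
move=> certD; elim: k c v r s => // k IHk c v r s E.
have just c' v' s' := certD (code [:: c'; v'; s']).
case: c E => [||i|f gs|f g|f] E /just; rewrite !cnthE /justified !cnthE.
- by case=> [[]|[]] []//= _ ->; case: E.
- case=> [[]|[]] []//= _ []; rewrite csizeE => _ ->.
  by case: v E => // x v [].
- case=> [[]|[]] []//= _ []; rewrite csizeE => ltiv ->.
  by move: E; rewrite /= ltiv => -[].
- case=> [[]|[]] []//= _ [w [_ [szw [Dg Df]]]].
  have [w' gsw' fw'] := reval_comp E.
  suff Ew : w = code w' by apply: IHk fw' _; rewrite -Ew.
  rewrite -[w]CodeSeq.decodeK; congr code.
  move: szw; rewrite /csize CodeSeq.codeK size_map => szw.
  have szw' : size w' = size gs by rewrite -[LHS](size_map Some) -gsw' size_map.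
  apply: (@eq_from_nth _ 0); first by rewrite szw' szw.
  move=> i lti; have ltig : i < size gs by rewrite -szw.
  have := Dg i lti; rewrite cnthE (nth_map RZero) //; apply: IHk.
  have := congr1 (fun s => nth None s i) gsw'.
  by rewrite (nth_map RZero) // (nth_map 0) ?szw'.
- case=> [[]|[]] []//= _ []; rewrite csizeE /cbehead !CodeSeq.codeK.
  case: v E => // x v E _; elim: x r s E => [|x IHx] r s E /=.
    by case=> [[_]|[? [_ []]]] //; apply: IHk.
  case=> [[]|[s' [_ [_ [Dprim Dg]]]]] //.
  move: E; rewrite /=; case E: (_ x) => [r'|] // Eg.
  suff Es : s' = r' by move: Dg; rewrite CodeSeq.codeK Es; apply: IHk Eg.
  apply: IHx E _; have := just _ _ _ Dprim.
  rewrite !cnthE /justified !cnthE; case=> [[]|[]] []//= _ [_].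
  by rewrite /cbehead !CodeSeq.codeK.
- case=> [[]|[]] []//= _; rewrite CodeSeq.codeK => -[Df Dy].
  have [fr fy] := reval_mu E.
  case: (ltngtP s r) => // [/fy[u Eu]|/Dy[u [_ Du]]].
    by have := IHk _ _ _ _ Eu Df.
  by have := IHk _ _ _ _ fr Du.
Qed.

Lemma recpred_mem k a b :
  recfun k a -> recfun k b -> recpred k (fun v => a v \in decode (b v)).
Proof.
apply: (recpred_app2 (P := fun a b => a \in decode b)).
apply: (recpred_ext (P := fun v => exists i, i < csize (nth 0 v 1) /\
  cnth (nth 0 v 1) i = nth 0 v 0)); last by rec_auto.
move=> v _; split=> [[i [lti <-]]|mem]; first exact: mem_nth.
by exists (index (nth 0 v 0) (decode (nth 0 v 1))); rewrite /csize index_mem /cnth nth_index.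
Qed.
#[local] Hint Resolve recpred_mem : recdb.

Lemma recpred_or4 k P Q R S : recpred k P -> recpred k Q -> recpred k R -> recpred k S ->
  recpred k (fun v => [\/ P v, Q v, R v | S v]).
Proof.
move=> recP recQ recR recS.
apply: recpred_ext (recpred_or recP (recpred_or recQ (recpred_or recR recS))) => v _.
split=> [[|[|[]]]|[]]; by [constructor 1|constructor 2|constructor 3|constructor 4|auto].
Qed.
#[local] Hint Resolve recpred_or4 : recdb.

Lemma recpred_certificate k b D :
  recfun k b -> recfun k D -> recpred k (fun v => certificate (b v) (decode (D v))).
Proof.
apply: (recpred_app2 (P := fun b D => certificate b (decode D))).
apply: (recpred_ext (P := fun v => forall i, i < csize (nth 0 v 1) ->
  justified (nth 0 v 0) (decode (nth 0 v 1)) (cnth (cnth (nth 0 v 1) i) 0)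
    (cnth (cnth (nth 0 v 1) i) 1) (cnth (cnth (nth 0 v 1) i) 2))).
  move=> v _; split=> [just J /(nthP 0)[i lti <-]|cert i lti]; first exact: just.
  by apply: cert; apply: mem_nth.
rewrite /justified; rec_auto.
Qed.
#[local] Hint Resolve recpred_certificate : recdb.

(** * The groups G(T) *)

Definition letter := (nat * bool)%type.

Section Coordinate.
Local Open Scope ring_scope.

Variables n M : nat.

(* Register, head position and cyclic tape of the machine of index [n] over Z/(M+2). *)
Definition state : Type :=
  ('Z_M.+2 * 'Z_(2 ^ n.+1) * {ffun 'Z_(2 ^ n.+1) -> 'Z_M.+2})%type.

(* Letter 0 moves the head, letter 1 increments the cell under the head, and
   letter 2 adds to the register the cell at distance [2 ^ n] from the head. *)
Definition step (st : state) (l : letter) : state :=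
  let: (a, h, f) := st in
  match l.1 with
  | 0%N => (a, h + (-1) ^+ (~~ l.2), f)
  | 1%N => (a, h, [ffun c => f c + (c == h)%:R * (-1) ^+ (~~ l.2)])
  | _ => (a + f (h + (2 ^ n)%:R) * (-1) ^+ (~~ l.2), h, f)
  end.

Lemma stepK g b : cancel (step^~ (g, b)) (step^~ (g, ~~ b)).
Proof.
have sgnK (A : pzRingType) : (-1) ^+ (~~ ~~ b) = - (-1) ^+ (~~ b) :> A.
  by case: b; rewrite /= ?expr0 ?expr1 ?opprK.
case=> [[a h] f]; case: g => [|[|g]] /=; rewrite sgnK.
- by rewrite addrK.
- by congr (_, _, _); apply/ffunP => c; rewrite !ffunE mulrN addrK.
- by rewrite mulrN addrK.
Qed.

Definition step_perm (g : nat) : {perm state} := perm (can_inj (stepK g true)).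

Definition letter_perm (l : letter) : {perm state} :=
  (if l.2 then step_perm l.1 else (step_perm l.1)^-1)%g.

Lemma letter_permE l st : letter_perm l st = step st l.
Proof.
case: l => g []; rewrite /letter_perm /=; first by rewrite permE.
have E : step_perm g (step st (g, false)) = st by rewrite permE; apply: (stepK g false).
by rewrite -{1}E permK.
Qed.

Definition word_perm (w : seq letter) : {perm state} :=
  foldr (fun l s => letter_perm l * s)%g 1%g w.

Lemma word_permE w st : word_perm w st = foldl step st w.
Proof.
elim: w st => [|l w IHw] st /=; first by rewrite perm1.
by rewrite permM letter_permE IHw.
Qed.

Lemma word_perm_cat w w' : word_perm (w ++ w') = (word_perm w * word_perm w')%g.
Proof. by elim: w => [|l w IHw] /=; rewrite ?mul1g // IHw mulgA. Qed.

End Coordinate.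

Definition word_inv (w : seq letter) : seq letter := rev (map (fun l => (l.1, ~~ l.2)) w).

Lemma word_perm_inv n M w : word_perm n M (word_inv w) = (word_perm n M w)^-1%g.
Proof.
elim: w => [|l w IHw]; first by rewrite invg1.
rewrite /word_inv /= rev_cons -cats1 word_perm_cat -/(word_inv w) IHw invMg /= mulg1.
by congr (_ * _)%g; case: l => g []; rewrite /letter_perm //= invgK.
Qed.

Section MachineGroup.

Variable T : nat -> nat.

(** The modulus is [j.2.+2]. As everything divides 0, an index with [T n = 0] carries machines of
    every modulus from 2 on. *)
Definition coord : Type := {j : nat * nat | j.2.+2 %| T j.1}.

Definition coord_perm : Type := forall j : coord, {perm state (sval j).1 (sval j).2}.

Definition word_coord (w : seq letter) : coord_perm := fun j => word_perm _ _ w.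

Definition valid_word (w : seq letter) : bool := all (fun l : letter => l.1 < 3) w.

(** The subgroup generated by the letters in the product of all the groups [{perm state}]. Words
    enter only through a proposition, so equal families are equal elements. *)
Definition machine_elt : Type :=
  {F : coord_perm | exists w, valid_word w /\ F = word_coord w}.

Lemma machine_elt_eq (x y : machine_elt) : (forall j, sval x j = sval y j) -> x = y.
Proof.
case: x y => [F wF] [F' wF'] /= eqF.
have {eqF} E : F = F' by apply: functional_extensionality_dep.
by case: _ / E wF' => wF'; congr exist; apply: proof_irrelevance.
Qed.

Lemma machine_mulP (x y : machine_elt) :
  exists w, valid_word w /\ (fun j => sval x j * sval y j)%g = word_coord w.
Proof.
have [[w [okw ->]] [w' [okw' ->]]] := (svalP x, svalP y); exists (w ++ w').
split; first by rewrite /valid_word all_cat; apply/andP.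
by apply: functional_extensionality_dep => j; rewrite /word_coord word_perm_cat.
Qed.

Lemma machine_invP (x : machine_elt) :
  exists w, valid_word w /\ (fun j => (sval x j)^-1)%g = word_coord w.
Proof.
have [w [okw ->]] := svalP x; exists (word_inv w).
split; first by rewrite /valid_word /word_inv all_rev all_map.
by apply: functional_extensionality_dep => j; rewrite /word_coord word_perm_inv.
Qed.

Lemma machine_wordP (w : seq letter) :
  valid_word w -> exists w', valid_word w' /\ word_coord w = word_coord w'.
Proof. by exists w. Qed.

Definition machine_mul (x y : machine_elt) : machine_elt := exist _ _ (machine_mulP x y).
Definition machine_inv (x : machine_elt) : machine_elt := exist _ _ (machine_invP x).
Definition machine_one : machine_elt := exist _ _ (@machine_wordP [::] isT).

Lemma valid_gen (i : nat) : valid_word (if i < 3 then [:: (i, true)] else [::]).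
Proof. by case: ifP => //= ->. Qed.

Definition machine_gen (i : nat) : machine_elt := exist _ _ (machine_wordP (valid_gen i)).

Lemma machine_mulA x y z :
  machine_mul x (machine_mul y z) = machine_mul (machine_mul x y) z.
Proof. by apply: machine_elt_eq => j /=; rewrite mulgA. Qed.

Lemma machine_mul1 x : machine_mul machine_one x = x.
Proof. by apply: machine_elt_eq => j /=; rewrite mul1g. Qed.

Lemma machine_mulV x : machine_mul (machine_inv x) x = machine_one.
Proof. by apply: machine_elt_eq => j /=; rewrite mulVg. Qed.

Definition machine_val (w : seq letter) : machine_elt :=
  foldr (fun p acc => machine_mul
    (if p.2 then machine_gen p.1 else machine_inv (machine_gen p.1)) acc) machine_one w.

Lemma machine_valE w : valid_word w -> forall j, sval (machine_val w) j = word_perm _ _ w.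
Proof.
elim: w => [|[g b] w IHw] //= /andP[g3 /IHw {}IHw] j; rewrite IHw.
by case: b => /=; rewrite /word_coord g3 /= mulg1.
Qed.

Lemma machine_generates x : exists w : seq (nat * bool),
  all (fun p => p.1 < 3) w /\ x = machine_val w.
Proof.
have [w [okw E]] := svalP x; exists w; split=> //.
by apply: machine_elt_eq => j; rewrite machine_valE // E.
Qed.

Definition machineGroup : fgGroup :=
  FgGroup machine_mulA machine_mul1 machine_mulV machine_generates.

Lemma machine_word_eq w w' : valid_word w -> valid_word w' ->
  (word_val machineGroup w = word_val machineGroup w' <->
   forall n M, M.+2 %| T n -> forall st : state n M,
     foldl (@step n M) st w = foldl (@step n M) st w').
Proof.
move=> okw okw'; split=> [E n M dvdM st|E].
  have /= := congr1 (fun x : machine_elt => sval x (exist _ (n, M) dvdM) st) E.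
  by rewrite !machine_valE //= !word_permE.
apply: machine_elt_eq => -[[n M] dvdM]; rewrite !machine_valE //=.
by apply/permP => st; rewrite !word_permE E.
Qed.

(** Each coordinate is a homomorphism to a finite symmetric group, and an element trivial in all
    coordinates is the identity. *)
Lemma machine_residually_finite : residually_finite machineGroup.
Proof.
move=> x xN1.
have [j xj] : exists j, sval x j <> 1%g.
  apply: NNPP => nex; apply: xN1; apply: machine_elt_eq => j /=.
  by apply: NNPP => xj; apply: nex; exists j.
by exists {perm state (sval j).1 (sval j).2}, (fun y => sval y j).
Qed.

End MachineGroup.

(** * The word problem of G(T) *)

Lemma eq_Zp_nat p a b : 1 < p -> (a%:R == b%:R :> 'Z_p)%R = (a == b %[mod p]).
Proof. by move=> p1; rewrite -val_eqE /= !val_Zp_nat. Qed.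

Section Word.

Variable w : seq letter.
Local Notation L := (size w).
Local Notation l := (nth (0, true) w).

Definition tcount (b : bool) (i : nat) : nat := \sum_(j < i) (l j == (0, b)).

(* The head position after [i] letters, shifted by [L] to stay in [nat]. *)
Definition hpos (i : nat) : nat := L + tcount true i - tcount false i.

Definition lcount (g : nat) (b : bool) (c : nat) : nat :=
  \sum_(j < L) ((l j == (g, b)) && (hpos j == c)).

(* Pairs of an increment and a later read of the incremented cell. *)
Definition pcount (n : nat) (b b' : bool) : nat :=
  \sum_(k < L) \sum_(j < k) [&& l j == (1, b), l k == (2, b') &
                               hpos j == hpos k + 2 ^ n %[mod 2 ^ n.+1]].

Lemma tcount_le b i : tcount b i <= i.
Proof.
rewrite -[leqRHS]card_ord -sum1_card leq_sum // => j _; exact: leq_b1.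
Qed.

Lemma hpos_le i : i <= L -> hpos i <= L.*2.
Proof.
move=> leiL; rewrite leq_subLR -addnn addnCA leq_add2l.
by rewrite (leq_trans (tcount_le _ _)) // (leq_trans leiL) // leq_addl.
Qed.

Lemma hposK i : i <= L -> hpos i + tcount false i = L + tcount true i.
Proof.
move=> leiL; rewrite subnK // (leq_trans (tcount_le _ _)) //.
by rewrite (leq_trans leiL) // leq_addr.
Qed.

Local Open Scope ring_scope.

Definition lsgn (A : pzRingType) (j : nat) : A := (-1) ^+ (~~ (l j).2).

Lemma lsgn_sum (A : pzRingType) m g (P : nat -> bool) :
  \sum_(j < m) (((l j).1 == g) && P j)%:R * lsgn A j =
  (\sum_(j < m) ((l j == (g, true)) && P j))%:R
   - (\sum_(j < m) ((l j == (g, false)) && P j))%:R.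
Proof.
rewrite !natr_sum -sumrB; apply: eq_bigr => j _; rewrite /lsgn.
case: (l j) => g' b; rewrite !xpair_eqE /=.
by case: (g' == g); case: (P j); case: b; rewrite /= ?mulr1 ?mul0r ?mul1r ?subr0 ?sub0r.
Qed.

Section InCoordinate.

Variables n M : nat.
Local Notation C := 'Z_(2 ^ n.+1).
Local Notation R := 'Z_M.+2.

Definition hrel (i : nat) : C := \sum_(j < i) ((l j).1 == 0%N)%:R * lsgn C j.

Lemma hrelS i : hrel i.+1 = hrel i + ((l i).1 == 0%N)%:R * lsgn C i.
Proof. by rewrite /hrel big_ord_recr. Qed.

(** Closed form of a run, with positions relative to the start [h]. Each read collects the initial
    content of its cell and the increments made there earlier, which is where the pairs come
    from. *)
Lemma foldl_step_take i a h (f : {ffun C -> R}) : (i <= L)%N -> valid_word w ->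
  foldl (@step n M) (a, h, f) (take i w) =
  (a + \sum_(k < i) ((l k).1 == 2%N)%:R * lsgn R k * (f (h + hrel k + (2 ^ n)%:R) +
     \sum_(j < k) (((l j).1 == 1%N) && (hrel j == hrel k + (2 ^ n)%:R))%:R * lsgn R j),
   h + hrel i,
   [ffun c => f c + \sum_(j < i) (((l j).1 == 1%N) && (h + hrel j == c))%:R * lsgn R j]).
Proof.
move=> leiL okw; elim: i leiL => [|i IHi] leiL.
  rewrite take0 /= big_ord0 addr0 /hrel big_ord0 addr0; congr (_, _, _).
  by apply/ffunP => c; rewrite ffunE big_ord0 addr0.
rewrite (take_nth (0, true)) // -cats1 foldl_cat (IHi (ltnW leiL)) /=.
have : ((l i).1 < 3)%N by apply: (allP okw); apply: mem_nth.
rewrite hrelS big_ord_recr /=; under [in RHS]eq_ffun do rewrite big_ord_recr /=.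
have lsgnE A : lsgn A i = (-1) ^+ (~~ (l i).2) by [].
rewrite !(lsgnE C) !(lsgnE R).
case: (l i) => -[|[|[|g]]] b //= _; rewrite !mulr0n ?mulr1n.
- rewrite !mul0r !mul1r !addr0 addrA; congr (_, _, _).
  by apply/ffunP => c; rewrite !ffunE addr0.
- rewrite !mul0r !addr0; congr (_, _, _).
  by apply/ffunP => c; rewrite !ffunE addrA (eq_sym c).
- rewrite !mul0r !mul1r !addr0; congr (_, _, _).
    rewrite -[LHS]addrA; congr (_ + (_ + _)); rewrite ffunE mulrC; congr (_ * (_ + _)).
    apply: eq_bigr => j _; congr ((_ && _)%:R * _).
    by rewrite -addrA (inj_eq (addrI h)).
  by apply/ffunP => c; rewrite !ffunE addr0.
Qed.

(** The initial tape is arbitrary, so in the register the part linear in the tape and the constant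
    part vanish separately: the first gives the net reads at each position, the second the signed
    pairs. The final tape gives the net increments. *)
Lemma foldl_step_trivial : valid_word w ->
  (forall st : state n M, foldl (@step n M) st w = st) <->
  [/\ hrel L = 0,
      forall (g : nat) c, (g == 1%N) || (g == 2%N) ->
        \sum_(j < L) (((l j).1 == g) && (hrel j == c))%:R * lsgn R j = 0 &
      \sum_(k < L) \sum_(j < k) [&& (l j).1 == 1%N, (l k).1 == 2%N &
        hrel j == hrel k + (2 ^ n)%:R]%:R * (lsgn R j * lsgn R k) = 0].
Proof.
move=> okw.
have run a h (f : {ffun C -> R}) := foldl_step_take a h f (leqnn L) okw.
rewrite take_size in run.
have split_a (f : {ffun C -> R}) h :
  \sum_(k < L) ((l k).1 == 2%N)%:R * lsgn R k * (f (h + hrel k + (2 ^ n)%:R) +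
     \sum_(j < k) (((l j).1 == 1%N) && (hrel j == hrel k + (2 ^ n)%:R))%:R * lsgn R j) =
  \sum_(k < L) ((l k).1 == 2%N)%:R * lsgn R k * f (h + hrel k + (2 ^ n)%:R) +
  \sum_(k < L) \sum_(j < k) [&& (l j).1 == 1%N, (l k).1 == 2%N &
        hrel j == hrel k + (2 ^ n)%:R]%:R * (lsgn R j * lsgn R k).
  rewrite -big_split; apply: eq_bigr => k _ /=; rewrite mulrDr; congr (_ + _).
  rewrite mulr_sumr; apply: eq_bigr => j _.
  case: (_ == 1%N); case: (_ == 2%N); case: (hrel j == _); rewrite /= ?mul0r ?mulr0 //.
  by rewrite !mul1r mulrC.
have pinv (a a' : R) (h h' : C) (f f' : {ffun C -> R}) :
  (a, h, f) = (a', h', f') -> [/\ a = a', h = h' & f = f'] by case.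
split=> [triv|[h0 lg0 pair0] [[a h] f]].
  have inv a h f := pinv _ _ _ _ _ _ (etrans (esym (run a h f)) (triv (a, h, f))).
  (* The zero tape isolates the pair sum, and its final content gives the net increments. *)
  have [] := inv 0 0 0; rewrite split_a !add0r.
  rewrite [X in X + _]big1 ?add0r => [pair0 h0 f0|k _]; last by rewrite ffunE mulr0.
  split=> // g c /orP[]/eqP->.
    move/ffunP/(_ c): f0; rewrite !ffunE add0r.
    by under eq_bigr do rewrite add0r.
  (* A tape with a single 1 makes the register count only the reads at relative position [c]. *)
  pose f : {ffun C -> R} := [ffun d => (d == c + (2 ^ n)%:R)%:R].
  have [] := inv 0 0 f; rewrite split_a pair0 addr0 add0r => E _ _; rewrite -[RHS]E.
  apply: eq_bigr => k _; rewrite ffunE add0r (inj_eq (addIr _)).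
  by case: (_ == 2%N); case: (_ == c); rewrite /= ?mul0r ?mul1r ?mulr1 ?mulr0.
rewrite run h0 addr0 split_a pair0 addr0; congr (_, _, _); last first.
  apply/ffunP => c; rewrite ffunE -[RHS]addr0; congr (_ + _).
  rewrite -[RHS](lg0 1%N (c - h)) //; apply: eq_bigr => j _.
  by rewrite (addrC h) -subr_eq0 -(subr_eq0 _ (c - h)) opprB addrA.
rewrite -[RHS]addr0; congr (_ + _).
(* Group the reads by head position; the net number at each position is 0. *)
have -> : \sum_(k < L) ((l k).1 == 2%N)%:R * lsgn R k * f (h + hrel k + (2 ^ n)%:R) =
    \sum_(c : C) f (h + c + (2 ^ n)%:R) *
      \sum_(k < L) (((l k).1 == 2%N) && (hrel k == c))%:R * lsgn R k.
  under [RHS]eq_bigr do rewrite mulr_sumr.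
  rewrite exchange_big; apply: eq_bigr => k _ /=.
  rewrite (bigD1 (hrel k)) //= eqxx andbT big1 ?addr0 => [|c /negPf neqc].
    by rewrite mulrC.
  by rewrite (eq_sym _ c) neqc andbF mul0r mulr0.
by rewrite big1 // => c _; rewrite lg0 ?mulr0.
Qed.

Lemma hrelE i : (i <= L)%N -> hrel i = (hpos i)%:R - L%:R.
Proof.
move=> leiL.
have -> : hrel i = (tcount true i)%:R - (tcount false i)%:R.
  rewrite /tcount !natr_sum -sumrB; apply: eq_bigr => j _; rewrite /lsgn.
  case: (l j) => g b; rewrite !xpair_eqE /=.
  by case: (g == 0%N); case: b; rewrite /= ?mulr1 ?mul0r ?mul1r ?subr0 ?sub0r.
apply: (addIr (tcount false i)%:R); rewrite subrK addrAC -natrD hposK //.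
by rewrite natrD addrAC subrr add0r.
Qed.

Lemma hrel_eq i c : (i <= L)%N ->
  (hrel i == c%:R - L%:R) = (hpos i == c %[mod 2 ^ n.+1]).
Proof.
by move=> leiL; rewrite hrelE // (inj_eq (addIr _)) eq_Zp_nat // (ltn_exp2l 0).
Qed.

Lemma hrel_pair j k : (j < L)%N -> (k < L)%N ->
  (hrel j == hrel k + (2 ^ n)%:R) = (hpos j == hpos k + 2 ^ n %[mod 2 ^ n.+1])%N.
Proof.
move=> /ltnW lejL /ltnW lekL; rewrite -hrel_eq // (hrelE lekL).
by rewrite (natrD _ (hpos k)) addrAC.
Qed.

Lemma lsgn_pairs :
  \sum_(k < L) \sum_(j < k) [&& (l j).1 == 1%N, (l k).1 == 2%N &
    hrel j == hrel k + (2 ^ n)%:R]%:R * (lsgn R j * lsgn R k) =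
  (pcount n true true + pcount n false false)%:R
   - (pcount n true false + pcount n false true)%:R.
Proof.
rewrite /pcount !natrD !natr_sum -!big_split -sumrB; apply: eq_bigr => k _ /=.
rewrite !natr_sum -!big_split -sumrB; apply: eq_bigr => j _ /=.
rewrite hrel_pair ?(ltn_trans (ltn_ord j)) // /lsgn; move: (_ == _ %[mod _]) => e.
case: (l j) => g b; case: (l k) => g' b'; rewrite !xpair_eqE /=.
case: (g == 1%N); case: (g' == 2%N); case: e; case: b; case: b' => /=;
  by rewrite ?(mul0r, mulr1, mul1r, mulN1r, opprK, oppr0, addr0, add0r).
Qed.

Lemma natr_sub_eq0 a b : (a%:R - b%:R = 0 :> R) <-> a = b %[mod M.+2].
Proof. by rewrite (rwP eqP) subr_eq0 eq_Zp_nat //; split=> /eqP. Qed.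

Lemma trivial_coordinateP : valid_word w ->
  (forall st : state n M, foldl (@step n M) st w = st) <->
  [/\ tcount true L = tcount false L %[mod 2 ^ n.+1],
      forall (g : nat) c, (g == 1%N) || (g == 2%N) ->
        \sum_(j < L) ((l j == (g, true)) && (hpos j == c %[mod 2 ^ n.+1])) =
        \sum_(j < L) ((l j == (g, false)) && (hpos j == c %[mod 2 ^ n.+1]))
          %[mod M.+2] &
      pcount n true true + pcount n false false =
      pcount n true false + pcount n false true %[mod M.+2]]%N.
Proof.
move=> /foldl_step_trivial ->; rewrite lsgn_pairs.
have N1 : (1 < 2 ^ n.+1)%N by rewrite (ltn_exp2l 0).
have hrel0 : hrel L = 0 <-> tcount true L = tcount false L %[mod 2 ^ n.+1].
  rewrite hrelE // (rwP eqP) subr_eq0 eq_Zp_nat //.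
  have E := hposK (leqnn L).
  have E1 : (hpos L + tcount false L == L + tcount false L %[mod 2 ^ n.+1]) =
            (L + tcount true L == L + tcount false L %[mod 2 ^ n.+1]) by rewrite E.
  rewrite eqn_modDr eqn_modDl in E1; by rewrite E1; split=> /eqP.
have sumE g c : \sum_(j < L) (((l j).1 == g) && (hrel j == c%:R - L%:R))%:R * lsgn R j
    = (\sum_(j < L) ((l j == (g, true)) && (hpos j == c %[mod 2 ^ n.+1])))%:R
    - (\sum_(j < L) ((l j == (g, false)) && (hpos j == c %[mod 2 ^ n.+1])))%:R.
  rewrite -(lsgn_sum R L g (fun j => hpos j == c %[mod 2 ^ n.+1])).
  by apply: eq_bigr => j _; rewrite hrel_eq // ltnW.
split=> -[H1 H2 H3].
  split=> [|g c hg|]; [exact: hrel0.1 | | exact/natr_sub_eq0].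
  by apply/natr_sub_eq0; rewrite -sumE H2.
split=> [|g c hg|]; [exact: hrel0.2 | | exact/natr_sub_eq0].
(* This undoes the shift by [L] built into [hpos], so that the residue [c] comes from a natural
   number. *)
have -> : c = (val (c + L%:R))%:R - L%:R.
  by rewrite natr_Zp addrK.
by rewrite sumE; apply/natr_sub_eq0/H2.
Qed.

End InCoordinate.

Local Close Scope ring_scope.

(** Shifted head positions are at most [L.*2]. At the index [L.*2], where [T] vanishes, the tape is
    longer than that and every modulus occurs, so congruences become equalities. For larger [n], two
    positions never differ by [2 ^ n] modulo [2 ^ n.+1], so only finitely many indices impose a pair
    condition. *)
Lemma word_trivialP (T : nat -> nat) :
    (forall n, T n.*2 = 0) -> (forall n, T n <> 1) -> valid_word w ->
  (forall n M, M.+2 %| T n -> forall st : state n M, foldl (@step n M) st w = st) <->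
  [/\ tcount true L = tcount false L,
      forall c, c < L.*2.+1 -> lcount 1 true c = lcount 1 false c,
      forall c, c < L.*2.+1 -> lcount 2 true c = lcount 2 false c &
      forall n, n < L.*2.+1 -> pcount n true true + pcount n false false =
        pcount n true false + pcount n false true %[mod T n]].
Proof.
move=> T0 T1 okw; split=> [triv|[t0 x0 y0 p0] n M dvdM].
  have coordP n M dvdM := (trivial_coordinateP n M okw).1 (triv n M dvdM).
  have ltexp : L.*2 < 2 ^ L.*2.+1 by rewrite ltnW // ltn_expl.
  have small : forall i, i <= L.*2 -> i %% 2 ^ L.*2.+1 = i.
    by move=> i lei; rewrite modn_small // (leq_ltn_trans lei).
  have big_mod a b : (forall M, a = b %[mod M.+2]) -> a = b.
    move=> /(_ (a + b)); rewrite !modn_small // ltnS ltnW // ltnS ?leq_addr //.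
    exact: leq_addl.
  have dvd0 M : M.+2 %| T L.*2 by rewrite T0.
  have lcountE g c : (g == 1) || (g == 2) -> c < L.*2.+1 ->
      lcount g true c = lcount g false c.
    move=> hg ltc; apply: big_mod => M.
    have [_ /(_ g c hg) + _] := coordP _ _ (dvd0 M).
    suff eq_count b : \sum_(j < L) ((l j == (g, b)) && (hpos j == c %[mod 2 ^ (L.*2).+1]))
      = lcount g b c by rewrite !eq_count.
    apply: eq_bigr => j _; congr (nat_of_bool (_ && _)).
    by rewrite (small c) // small // hpos_le // ltnW.
  split=> [|c ltc|c ltc|n ltn].
  - have [+ _ _] := coordP _ _ (dvd0 0).
    have leL2 : L <= L.*2 by rewrite -addnn leq_addl.
    by rewrite !small // (leq_trans (tcount_le _ _)).
  - exact: lcountE.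
  - exact: lcountE.
  (* If [T n = 0], every modulus is available and equality follows; otherwise [T n] itself is the
     modulus of a machine. *)
  - case: (T n) (T1 n) (coordP n) => [|[|p]] // _ {}coordP.
      by congr (_ %% _); apply: big_mod => M; have [] := coordP M (dvdn0 _).
    by have [] := coordP p (dvdnn _).
apply/(trivial_coordinateP n M okw); split.
- by rewrite t0.
- move=> g c hg; congr (_ %% _).
  (* The count in a residue class is the sum of the exact counts at the positions in that class. *)
  suff part b : \sum_(j < L) ((l j == (g, b)) && (hpos j == c %[mod 2 ^ n.+1])) =
      \sum_(d < L.*2.+1) (d == c %[mod 2 ^ n.+1]) * lcount g b d.
    rewrite !part; apply: eq_bigr => d _; congr (_ * _).
    by case/orP: hg => /eqP->; [apply: x0 | apply: y0].
  under [RHS]eq_bigr do rewrite /lcount big_distrr.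
  rewrite exchange_big; apply: eq_bigr => j _ /=.
  have ltj : hpos j < L.*2.+1 by rewrite ltnS hpos_le // ltnW.
  rewrite (bigD1 (Ordinal ltj)) //= eqxx andbT big1 => [|d].
    by rewrite addn0 mulnb andbC.
  by rewrite -val_eqE /= eq_sym => /negPf->; rewrite andbF muln0.
- have [ltn|gtn] := ltnP n L.*2.+1.
    apply/eqP; rewrite -(modn_dvdm _ dvdM) -[X in _ == X](modn_dvdm _ dvdM).
    by rewrite p0.
  suff p00 b b' : pcount n b b' = 0 by rewrite !p00.
  rewrite /pcount big1 // => k _; rewrite big1 // => j _.
  have lt2n i : i <= L -> hpos i < 2 ^ n.
    move=> /hpos_le lei; apply: leq_ltn_trans lei _.
    by rewrite (ltn_trans gtn) // ltn_expl.
  have ltk := ltn_ord k; have ltj := ltn_trans (ltn_ord j) ltk.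
  rewrite [hpos j %% _]modn_small ?[(hpos k + _) %% _]modn_small.
  + rewrite (_ : _ == _ + _ = false) ?andbF //; apply/negbTE.
    by rewrite neq_ltn (leq_trans (lt2n _ (ltnW ltj))) // leq_addl.
  + by rewrite expnS mul2n -addnn ltn_add2r lt2n // ltnW.
  + by rewrite (leq_trans (lt2n _ (ltnW ltj))) // leq_exp2l.
Qed.

End Word.

(** * Computing the counts from the code of a word *)

Lemma recpred_eqmodb k a b p : recfun k a -> recfun k b -> recfun k p ->
  recpred k (fun v => a v == b v %[mod p v]).
Proof.
move=> reca recb recp; apply: recpred_ext (recpred_eqmod reca recb recp) => v _.
by split=> /eqP.
Qed.
#[local] Hint Resolve recpred_eqmodb : recdb.

Definition ctcount (m : nat) (b : bool) (i : nat) : nat :=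
  \sum_(0 <= j < i) (cnth m j == pickle (0, b)).

Definition chpos (m i : nat) : nat := csize m + ctcount m true i - ctcount m false i.

Definition clcount (m g : nat) (b : bool) (c : nat) : nat :=
  \sum_(0 <= j < csize m) ((cnth m j == pickle (g, b)) && (chpos m j == c)).

Definition cpcount (m n : nat) (b b' : bool) : nat :=
  \sum_(0 <= k < csize m) \sum_(0 <= j < k)
    [&& cnth m j == pickle (1, b), cnth m k == pickle (2, b') &
        chpos m j == chpos m k + 2 ^ n %[mod 2 ^ n.+1]].

Lemma recfun_ctcount k m b i :
  recfun k m -> recfun k i -> recfun k (fun v => ctcount (m v) b (i v)).
Proof. by apply: (recfun_app2 (f := fun m i => ctcount m b i)); rewrite /ctcount; rec_auto. Qed.
#[local] Hint Resolve recfun_ctcount : recdb.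

Lemma recfun_chpos k m i : recfun k m -> recfun k i -> recfun k (fun v => chpos (m v) (i v)).
Proof. by apply: recfun_app2; rewrite /chpos; rec_auto. Qed.
#[local] Hint Resolve recfun_chpos : recdb.

Lemma recfun_clcount k m g b c :
  recfun k m -> recfun k c -> recfun k (fun v => clcount (m v) g b (c v)).
Proof. by apply: (recfun_app2 (f := fun m c => clcount m g b c)); rewrite /clcount; rec_auto. Qed.

Lemma recfun_cpcount k m n b b' :
  recfun k m -> recfun k n -> recfun k (fun v => cpcount (m v) (n v) b b').
Proof. by apply: (recfun_app2 (f := fun m n => cpcount m n b b')); rewrite /cpcount; rec_auto. Qed.
#[local] Hint Resolve recfun_clcount recfun_cpcount : recdb.

Section WordCode.

Variable w : seq letter.

Lemma csize_pickle : csize (pickle w) = size w.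
Proof. by rewrite csizeE size_map. Qed.

Lemma cnth_pickle j (l : letter) : j < size w ->
  (cnth (pickle w) j == pickle l) = (nth (0, true) w j == l).
Proof.
move=> ltj; rewrite cnthE (nth_map (0, true)) //.
exact: (inj_eq (pcan_inj pickleK)).
Qed.

Lemma ctcountE b i : i <= size w -> ctcount (pickle w) b i = tcount w b i.
Proof.
move=> lei; rewrite /ctcount big_mkord; apply: eq_bigr => j _.
by rewrite cnth_pickle // (leq_trans (ltn_ord j)).
Qed.

Lemma chposE i : i <= size w -> chpos (pickle w) i = hpos w i.
Proof. by move=> lei; rewrite /chpos csize_pickle !ctcountE. Qed.

Lemma clcountE g b c : clcount (pickle w) g b c = lcount w g b c.
Proof.
rewrite /clcount csize_pickle big_mkord; apply: eq_bigr => j _.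
by rewrite cnth_pickle // chposE // ltnW.
Qed.

Lemma cpcountE n b b' : cpcount (pickle w) n b b' = pcount w n b b'.
Proof.
rewrite /cpcount csize_pickle big_mkord; apply: eq_bigr => k _.
rewrite big_mkord; apply: eq_bigr => j _.
have ltj := ltn_trans (ltn_ord j) (ltn_ord k).
by rewrite !cnth_pickle // !chposE // ltnW.
Qed.

End WordCode.

Definition letter_codes : seq nat := [seq pickle (g, b) | g <- iota 0 3, b <- [:: true; false]].

Lemma valid_wordP m :
  (forall i, i < csize m -> cnth m i \in letter_codes) <->
  exists2 w, pickle w = m & valid_word w.
Proof.
split=> [mem|[w <- okw] i]; last first.
  rewrite csize_pickle => lti; rewrite cnthE (nth_map (0, true)) //.
  have /(allP okw) := mem_nth (0, true) lti; case: (nth _ w i) => g b /= g3.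
  by apply/allpairsP; exists (g, b); rewrite mem_iota /=; split=> //; case: b.
rewrite -(CodeSeq.decodeK m).
have {mem} : all [in letter_codes] (decode m) by apply/(all_nthP 0).
elim: (decode m) => [|x s IHs] /=; first by exists [::].
move=> /andP[/allpairsP[[g b] /= [gI _ ->]] /IHs[w Ew okw]]; exists ((g, b) :: w).
  rewrite -[LHS]/(code (pickle (g, b) :: map pickle w)).
  by congr (code (_ :: _)); apply: code_inj; apply: Ew.
by rewrite /= okw andbT; move: gI; rewrite !inE => /or3P[]/eqP->.
Qed.

Lemma machine_solvable_WP (T : nat -> nat) :
    (forall n, T n.*2 = 0) -> (forall n, T n <> 1) ->
    recpred 3 (fun v => nth 0 v 0 = nth 0 v 1 %[mod T (nth 0 v 2)]) ->
  solvable_WP (machineGroup T).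
Proof.
move=> T0 T1 recT.
have recmod k a b n : recfun k a -> recfun k b -> recfun k n ->
    recpred k (fun v => a v = b v %[mod T (n v)]).
  by apply: (recpred_app3 (P := fun a b n => a = b %[mod T n])).
(* The codes of the six letters enter the formula through one constant [K], so that membership has
   the shape of [recpred_mem]. *)
have [K KE] : exists K, decode K = letter_codes.
  by exists (code letter_codes); rewrite CodeSeq.codeK.
have recWP : recpred 1 (fun v => let m := nth 0 v 0 in
  (forall i, i < csize m -> cnth m i \in decode K) /\
  (ctcount m true (csize m) = ctcount m false (csize m) /\
  ((forall c, c < (csize m + csize m).+1 -> clcount m 1 true c = clcount m 1 false c) /\
  ((forall c, c < (csize m + csize m).+1 -> clcount m 2 true c = clcount m 2 false c) /\
   (forall n, n < (csize m + csize m).+1 -> cpcount m n true true + cpcount m n false false =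
        cpcount m n true false + cpcount m n false true %[mod T n]))))).
  by cbv zeta; rec_auto.
case: recWP => f [[c cP] fP]; exists c, (fun m => f [:: m]); split=> m.
  split=> [|k r]; first exact: cP.
  by have [//|k' E] := cP [:: m] => /reval_fun/(_ E).
have {fP} := fP [:: m] erefl; cbv zeta; rewrite [nth 0 _ 0]/= KE => <-.
split=> [[w [<- [okw /(machine_word_eq _ (w' := [::]) okw isT) triv]]]|].
  have [tE xE yE pE] := (word_trivialP T0 T1 okw).1 triv.
  split; first by apply/valid_wordP; exists w.
  rewrite csize_pickle addnn !ctcountE //.
  split=> //; split=> [d ltd|]; first by rewrite !clcountE xE.
  split=> [d ltd|n ltn]; first by rewrite !clcountE yE.
  by rewrite !cpcountE pE.
case=> /valid_wordP[w <- okw]; rewrite csize_pickle addnn !ctcountE //.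
case=> tE [xE [yE pE]]; exists w; split=> //; split=> //.
apply/(machine_word_eq _ (w' := [::]) okw isT)/(word_trivialP T0 T1 okw).
split=> // [d /xE|d /yE|n /pE]; by rewrite ?clcountE ?cpcountE.
Qed.

(** * Marked finite groups *)

Definition ctmul (ct a b : nat) : nat := cnth (cnth ct a) b.

(** The identity [e] is an argument because a table does not name its neutral element. *)
Definition ctpow (ct e x k : nat) : nat := iteri k (fun _ r => ctmul ct x r) e.

Definition ctable (t : seq (seq nat)) : nat := code (map code t).

Lemma ctmulE t : ctmul (ctable t) = tmul t.
Proof.
apply: functional_extensionality => x; apply: functional_extensionality => y.
rewrite /ctmul cnthE /tmul.
have [lta|lea] := ltnP x (size t); first by rewrite (nth_map [::]) // cnthE.
by rewrite !nth_default ?size_map // (cnthE [::]) nth_nil.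
Qed.

Lemma crow_sizeE t a : csize (cnth (ctable t) a) = size (nth [::] t a).
Proof.
rewrite cnthE.
have [lta|lea] := ltnP a (size t); first by rewrite (nth_map [::]) // csizeE.
by rewrite !nth_default ?size_map // (csizeE [::]).
Qed.

Lemma pickle_marking (t : seq (seq nat)) (fl : seq nat) :
  pickle (t, fl) = code [:: ctable t; code fl].
Proof.
rewrite -[LHS]/(code [:: code (map (fun s => code (map id s)) t); code (map id fl)]).
by rewrite map_id (eq_map (g := code)) // => s; rewrite map_id.
Qed.

Lemma ctable_surj ct : exists t, ct = ctable t.
Proof.
exists (map decode (decode ct)); rewrite /ctable -map_comp.
by rewrite (eq_map (g := id)) ?map_id ?CodeSeq.decodeK // => x; apply: CodeSeq.decodeK.
Qed.

(** The quantifiers of [valid_table] are rearranged so that each is followed at once by its bound,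
    the shape that [rec_auto] handles. *)
Definition cvalid_table (ct : nat) : Prop :=
  0 < csize ct /\
  ((forall a, a < csize ct -> csize (cnth ct a) = csize ct) /\
  ((forall a, a < csize ct -> forall b, b < csize ct -> ctmul ct a b < csize ct) /\
  ((forall a, a < csize ct -> forall b, b < csize ct -> forall c, c < csize ct ->
      ctmul ct a (ctmul ct b c) = ctmul ct (ctmul ct a b) c) /\
  (exists e, e < csize ct /\
     ((forall a, a < csize ct -> ctmul ct e a = a /\ ctmul ct a e = a) /\
      (forall a, a < csize ct ->
         exists b, b < csize ct /\ (ctmul ct a b = e /\ ctmul ct b a = e))))))).

Lemma cvalid_tableP t : cvalid_table (ctable t) <-> valid_table t.
Proof.
rewrite /cvalid_table /valid_table ctmulE csizeE size_map.
split=> -[m0 [rows [mul [assoc ids]]]].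
  split=> //; split=> [a /rows|]; first by rewrite crow_sizeE.
  split=> [a b lta|]; first exact: mul.
  by split=> // a b c lta ltb; apply: assoc.
split=> //; split=> [a /rows|]; first by rewrite crow_sizeE.
split=> [a lta b|]; first exact: mul.
by split=> // a lta b ltb c; apply: assoc.
Qed.

Lemma recpred_cvalid_table k ct :
  recfun k ct -> recpred k (fun v => cvalid_table (ct v)).
Proof. by apply: recpred_app1; rewrite /cvalid_table /ctmul; rec_auto. Qed.
#[local] Hint Resolve recpred_cvalid_table : recdb.

Section GroupTable.

Variable F : finGroupType.

Definition grank (x : F) : nat := index x (enum F).

Definition gtable : seq (seq nat) :=
  mkseq (fun a => mkseq (fun b => grank (nth 1 (enum F) a * nth 1 (enum F) b)%g) #|F|) #|F|.

Lemma grank_lt x : grank x < #|F|.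
Proof. by rewrite cardE index_mem mem_enum. Qed.

Lemma nth_grank x : nth 1%g (enum F) (grank x) = x.
Proof. by rewrite nth_index // mem_enum. Qed.

Lemma grank_inj : injective grank.
Proof. exact: can_inj nth_grank. Qed.

Lemma grank_nth a : a < #|F| -> grank (nth 1%g (enum F) a) = a.
Proof. by move=> lta; rewrite /grank index_uniq ?enum_uniq // -cardE. Qed.

Lemma size_gtable : size gtable = #|F|.
Proof. exact: size_mkseq. Qed.

Lemma tmul_gtable x y : tmul gtable (grank x) (grank y) = grank (x * y)%g.
Proof. by rewrite /tmul !nth_mkseq ?grank_lt // !nth_grank. Qed.

Lemma grankP a : a < #|F| -> exists x, a = grank x.
Proof. by move=> /grank_nth <-; exists (nth 1%g (enum F) a). Qed.

Lemma gtable_valid : valid_table gtable.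
Proof.
rewrite /valid_table size_gtable; split; first by apply/card_gt0P; exists 1%g.
split; first by move=> a lta; rewrite nth_mkseq // size_mkseq.
split.
  by move=> _ _ /grankP[x ->] /grankP[y ->]; rewrite tmul_gtable grank_lt.
split.
  move=> _ _ _ /grankP[x ->] /grankP[y ->] /grankP[z ->].
  by rewrite !tmul_gtable mulgA.
exists (grank (1 : F)%g); split; first exact: grank_lt.
split=> _ /grankP[x ->]; first by rewrite !tmul_gtable mul1g mulg1.
by exists (grank x^-1%g); rewrite grank_lt !tmul_gtable mulgV mulVg.
Qed.

Lemma ctpow_gtable x k : ctpow (ctable gtable) (grank (1 : F)%g) (grank x) k = grank (x ^+ k)%g.
Proof.
rewrite /ctpow ctmulE; elim: k => [|k IHk] /=; first by rewrite expg0.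
by rewrite IHk tmul_gtable expgS.
Qed.

End GroupTable.

(** * Diagonalisation *)

(* [p] witnesses that the program [c] accepts a marked finite group [q] in which
   [t ^ (2 ^ n) x t ^ (- 2 ^ n)] does not commute with [y], and [x ^ p = x]. *)
Definition diagonal (n p : nat) : Prop :=
  1 < p /\ exists q, q < p /\ exists b, b < p /\ exists D, D < p /\ exists r, r < p /\
  exists c, c < n /\
  (n = (c + c).+1 /\ (csize q = 2 /\ (cvalid_table (cnth q 0) /\ (csize (cnth q 1) = 3 /\
  ((forall i, i < 3 -> cnth (cnth q 1) i < csize (cnth q 0)) /\
  (certificate b (decode D) /\ (code [:: c; code [:: q]; r.+1] \in decode D /\
  (forall e, e < csize (cnth q 0) -> ctmul (cnth q 0) e e = e ->
   forall u, u < csize (cnth q 0) ->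
   ctmul (cnth q 0) (ctpow (cnth q 0) e (cnth (cnth q 1) 0) (2 ^ n)) u = e ->
   ctpow (cnth q 0) e (cnth (cnth q 1) 1) p = cnth (cnth q 1) 1 /\
   ctmul (cnth q 0)
     (ctmul (cnth q 0) (ctpow (cnth q 0) e (cnth (cnth q 1) 0) (2 ^ n))
       (ctmul (cnth q 0) (cnth (cnth q 1) 1) u)) (cnth (cnth q 1) 2) <>
   ctmul (cnth q 0) (cnth (cnth q 1) 2)
     (ctmul (cnth q 0) (ctpow (cnth q 0) e (cnth (cnth q 1) 0) (2 ^ n))
       (ctmul (cnth q 0) (cnth (cnth q 1) 1) u)))))))))).

Lemma recpred_diagonal k n p :
  recfun k n -> recfun k p -> recpred k (fun v => diagonal (n v) (p v)).
Proof.
apply: (recpred_app2 (P := diagonal)); rewrite /diagonal /ctpow /ctmul; rec_auto.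
Qed.
#[local] Hint Resolve recpred_diagonal : recdb.

(** The value 0 encodes a failed search. [T] comes from classical choice; what gets decided later is
    congruence modulo [T n]. *)
Lemma least_diagonal : exists T : nat -> nat, forall n,
  (T n = 0 /\ forall p, ~ diagonal n p) \/
  (diagonal n (T n) /\ forall p, p < T n -> ~ diagonal n p).
Proof.
have [f [_ fP]] : recpred 2 (fun v => diagonal (nth 0 v 0) (nth 0 v 1)) by rec_auto.
have {}fP n p : diagonal n p <-> f [:: n; p] != 0.
  by rewrite (fP [:: n; p]) //; split=> /eqP.
suff Tex n : exists m, (m = 0 /\ forall p, ~ diagonal n p) \/
    (diagonal n m /\ forall p, p < m -> ~ diagonal n p).
  exists (fun n => proj1_sig (constructive_indefinite_description _ (Tex n))) => n.
  exact: proj2_sig (constructive_indefinite_description _ (Tex n)).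
case: (classic (exists p, f [:: n; p] != 0)) => [ex|nex].
  case: (ex_minnP ex) => m /fP dm min; exists m; right; split=> // p ltp /fP/min.
  by rewrite leqNgt ltp.
by exists 0; left; split=> // p /fP dp; apply: nex; exists p.
Qed.

Section DiagonalGroup.

Variable T : nat -> nat.
Hypothesis TP : forall n,
  (T n = 0 /\ forall p, ~ diagonal n p) \/
  (diagonal n (T n) /\ forall p, p < T n -> ~ diagonal n p).

(** [diagonal] holds only at odd indices [(c + c).+1]; this reserves the even ones for the value 0,
    as [word_trivialP] asks. *)
Lemma T_even n : T n.*2 = 0.
Proof.
case: (TP n.*2) => -[] // [_ [q [_ [b [_ [D [_ [r [_ [c [_ [/(congr1 odd)]]]]]]]]]]]].
by rewrite /= addnn !odd_double.
Qed.

Lemma T_neq1 n : T n <> 1.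
Proof. by move=> Tn; case: (TP n) => -[]; rewrite Tn // => -[]. Qed.

(** Congruence modulo a number above [a + b] is equality, so the search for the least [p] stops at
    [a + b], and whether [T n] is 0 never has to be decided. *)
Lemma recpred_eqmodT : recpred 3 (fun v => nth 0 v 0 = nth 0 v 1 %[mod T (nth 0 v 2)]).
Proof.
apply: (recpred_ext (P := fun v => nth 0 v 0 = nth 0 v 1 \/
  exists p, p < (nth 0 v 0 + nth 0 v 1).+1 /\ (diagonal (nth 0 v 2) p /\
    ((forall p', p' < p -> ~ diagonal (nth 0 v 2) p') /\
     nth 0 v 0 = nth 0 v 1 %[mod p])))); last by rec_auto.
move=> v _; move: (nth 0 v 0) (nth 0 v 1) (nth 0 v 2) => a b n; split.
  case=> [-> //|[p [_ [dp [minp Ep]]]]].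
  case: (TP n) => [[_ /(_ p)//]|[dT minT]].
  by case: (ltngtP p (T n)) => [/minT|/minp|<-].
case: (TP n) => [[-> _]|[dT minT] E]; first by rewrite !modn0; left.
have [leT|gtT] := leqP (T n) (a + b); first by right; exists (T n).
left; move: E; rewrite !modn_small //; apply: leq_ltn_trans gtT.
  exact: leq_addl.
exact: leq_addr.
Qed.

End DiagonalGroup.

(** * The conjugate of a power of x and its commutation with y *)

Definition conj_word (n p : nat) : seq letter :=
  nseq (2 ^ n) (0, true) ++ nseq p (1, true) ++ nseq (2 ^ n) (0, false).

Section ConjWord.
Local Open Scope ring_scope.

Variables k M : nat.
Local Notation C := 'Z_(2 ^ k.+1).
Local Notation R := 'Z_M.+2.

Lemma foldl_step_move a h f b m :
  foldl (@step k M) (a, h, f) (nseq m (0%N, b)) = (a, h + (-1) ^+ (~~ b) *+ m, f).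
Proof.
by elim: m h => [|m IHm] h /=; rewrite ?mulr0n ?addr0 // IHm mulrS addrA.
Qed.

Lemma foldl_step_incr a h f m :
  foldl (@step k M) (a, h, f) (nseq m (1%N, true)) =
  (a, h, [ffun c => f c + (c == h)%:R *+ m]).
Proof.
elim: m f => [|m IHm] f /=; last rewrite IHm; congr (_, _, _); apply/ffunP => c.
  by rewrite ffunE mulr0n addr0.
by rewrite !ffunE mulr1 mulrS addrA.
Qed.

Lemma foldl_step_conj a h f n p :
  foldl (@step k M) (a, h, f) (conj_word n p) =
  (a, h, [ffun c => f c + (c == h + (2 ^ n)%:R)%:R *+ p]).
Proof.
rewrite !foldl_cat foldl_step_move foldl_step_incr foldl_step_move /=.
by rewrite mulNrn addrK.
Qed.

(** For [n < k] both powers are their own residues and differ; for [n > k] the residue of [2 ^ n] is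
    0. *)
Lemma eq_exp2_mod n : (2 ^ k == 2 ^ n %[mod 2 ^ k.+1])%N = (n == k).
Proof.
case: (ltngtP n k) => [ltnk|ltkn|->]; last by rewrite eqxx.
  rewrite !modn_small ?ltn_exp2l //; last by rewrite ltnW.
  by rewrite eqn_exp2l // gtn_eqF.
have /eqP-> : (2 ^ n %% 2 ^ k.+1 == 0)%N by apply: dvdn_exp2l.
by rewrite modn_small ?ltn_exp2l // expn_eq0.
Qed.

Lemma eq_shift (h : C) n : (h + (2 ^ k)%:R == h + (2 ^ n)%:R) = (n == k).
Proof. by rewrite (inj_eq (addrI h)) eq_Zp_nat ?eq_exp2_mod // (ltn_exp2l 0). Qed.

End ConjWord.

(** The conjugate only alters the cell at distance [2 ^ n], which [y] reads only on machines of
    index [n]; there the change is [p], a multiple of the modulus. *)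
Lemma conj_word_comm T n p : T n %| p ->
  word_val (machineGroup T) (conj_word n p ++ [:: (2, true)]) =
  word_val (machineGroup T) ((2, true) :: conj_word n p).
Proof.
move=> dvdp.
have okw : valid_word (conj_word n p) by rewrite /valid_word !all_cat !all_nseq !orbT.
have okwy : valid_word (conj_word n p ++ [:: (2, true)]).
  by rewrite /valid_word all_cat; apply/andP.
apply/(machine_word_eq _ okwy (w' := (2, true) :: _) okw) => k M dvdM [[a h] f].
rewrite foldl_cat /= !foldl_step_conj /=; congr (_, _, _).
congr (_ + _ * _)%R; rewrite ffunE eq_shift.
case: eqP => [Enk|_]; last by rewrite mul0rn addr0.
have /dvdnP[m ->] : M.+2 %| p by apply: dvdn_trans dvdp; rewrite Enk.
by rewrite natrM pchar_Zp // mulr0 addr0.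
Qed.

(** From the zero state modulo 2, reading after the increment puts 1 in the register, and reading
    before it puts 0. *)
Lemma conj_word_noncomm n :
  word_perm n 0 (conj_word n 1 ++ [:: (2, true)]) <>
  word_perm n 0 ((2, true) :: conj_word n 1).
Proof.
pose st : state n 0 := (0, 0, [ffun => 0])%R.
move=> /permP/(_ st); rewrite !word_permE foldl_cat /st /= !foldl_step_conj /=.
move=> /(congr1 (fun s : state n 0 => s.1.1)) /=.
by rewrite !ffunE eq_shift eqxx.
Qed.

Lemma word_val_cat G w w' : word_val G (w ++ w') = gmul (word_val G w) (word_val G w').
Proof. by elim: w => [|l w IHw] /=; rewrite ?gmul1 // IHw gmulA. Qed.

Lemma hom_word_nseq G t (phi : carrier G -> nat) i k :
    (forall x y, phi (gmul x y) = tmul t (phi x) (phi y)) ->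
  phi (word_val G (nseq k (i, true))) =
  ctpow (ctable t) (phi (gone G)) (phi (gen G i)) k.
Proof.
move=> phiM; rewrite /ctpow ctmulE; elim: k => //= k IHk.
by rewrite phiM IHk.
Qed.

(** * No program decides the finite quotients of the group *)

Section NotCFQ.

Variable T : nat -> nat.
Hypothesis TP : forall n,
  (T n = 0 /\ forall p, ~ diagonal n p) \/
  (diagonal n (T n) /\ forall p, p < T n -> ~ diagonal n p).
Local Notation G := (machineGroup T).

Variables (c : rcode) (h : nat -> nat).
Hypothesis ch : computes c h.
Hypothesis hP : forall t fl, valid_marking G t fl ->
  (extends_to_hom G t fl <-> h (pickle (t, fl)) <> 0).
Local Notation n := (rcode_code c + rcode_code c).+1.

(** By soundness of certificates the program accepts the marking, which therefore extends to a
    homomorphism [phi]. As [x ^ p = x] in the image, [conj_word_comm] yields the commutation that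
    [diagonal] forbids. *)
Lemma accepted_not_diagonal p : T n %| p -> ~ diagonal n p.
Proof.
move=> dvdp [_ [q [_ [b [_ [D [_ [r [_ [c' [_ [En]]]]]]]]]]]].
have {c' En} <- : rcode_code c = c' by move: En => [] /eqP; rewrite !addnn => /eqP/double_inj.
have [s ->] : exists s, q = code s by exists (decode q); rewrite CodeSeq.decodeK.
rewrite csizeE !cnthE; case: s => [|ct [|cf [|? ?]]] /= [] // _.
have [t ->] := ctable_surj ct; rewrite -[cf]CodeSeq.decodeK.
move: (decode cf) => fl; rewrite cvalid_tableP !csizeE size_map ctmulE -pickle_marking.
move=> [okt [szfl [ltfl [certD [memD comm]]]]].
have okm : valid_marking G t fl.
  split=> //; split=> //; apply/(all_nthP 0) => i; rewrite szfl => /ltfl.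
  by rewrite cnthE.
have [[k Ek] _] := ch (pickle (t, fl)).
have [|phi [phi_lt [phiM phi_gen]]] := (hP okm).2.
  by rewrite -(certificate_sound certD Ek memD).
have phi_genE i : i < 3 -> cnth (code fl) i = phi (gen G i).
  by move=> lti; rewrite cnthE phi_gen.
pose one := phi (gone G); pose mov b := word_val G (nseq (2 ^ n) (0, b)).
pose inc p := word_val G (nseq p (1, true)).
have movE : ctpow (ctable t) one (cnth (code fl) 0) (2 ^ n) = phi (mov true).
  by rewrite phi_genE // (hom_word_nseq _ _ phiM).
have incE m : ctpow (ctable t) one (cnth (code fl) 1) m = phi (inc m).
  by rewrite phi_genE // (hom_word_nseq _ _ phiM).
(* [diagonal] describes the identity as an idempotent and the inverse of [t ^ (2 ^ n)] by an
   equation; the images under [phi] satisfy both. *)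
have oneE : tmul t one one = one by rewrite -phiM gmul1.
have movV : tmul t (phi (mov true)) (phi (mov false)) = one.
  rewrite -phiM -word_val_cat; congr phi.
  have okw : valid_word (nseq (2 ^ n) (0, true) ++ nseq (2 ^ n) (0, false)).
    by rewrite /valid_word all_cat !all_nseq !orbT.
  apply/(machine_word_eq _ okw (w' := [::]) isT) => k' M' _ [[a' h'] f'].
  rewrite foldl_cat !foldl_step_move /=.
  by rewrite mulNrn addrK.
have := comm one (phi_lt _) oneE (phi (mov false)) (phi_lt _).
rewrite movE => /(_ movV) []; rewrite incE => incp; apply.
rewrite -incp !phi_genE // -!phiM; congr phi.
have gmulr1 (x : carrier G) : gmul x (gone G) = x.
  by apply: machine_elt_eq => j /=; rewrite mulg1.
have yE : word_val G [:: (2, true)] = gen G 2 by apply: gmulr1.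
have conjE : word_val G (conj_word n p) = gmul (mov true) (gmul (inc p) (mov false)).
  by rewrite /conj_word word_val_cat (word_val_cat _ (nseq p _)).
have := conj_word_comm dvdp.
by rewrite (word_val_cat _ (conj_word n p)) yE conjE => ->; rewrite -conjE.
Qed.

(** When [T n = 0], the machine of index [n] modulo 2 is a coordinate of the group, so [c] must
    accept its permutation group marked by the generators; a certificate of that run supplies the
    witness. *)
Lemma rejected_diagonal : T n = 0 -> exists p, diagonal n p.
Proof.
move=> Tn0.
have dvd0 : 2 %| T n by rewrite Tn0.
pose F : finGroupType := {perm state n 0}.
pose psi (x : carrier G) : F := sval x (exist _ (n, 0) dvd0).
have psiM x y : psi (gmul x y) = (psi x * psi y)%g by [].
pose fl := [seq grank (psi (gen G i)) | i <- iota 0 3].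
have okm : valid_marking G (gtable F) fl.
  split; first exact: gtable_valid.
  by split=> //=; rewrite size_gtable !grank_lt.
have hq : h (pickle (gtable F, fl)) <> 0.
  apply/(hP okm); exists (fun x => grank (psi x)); split.
    by move=> x; rewrite size_gtable grank_lt.
  split=> [x y|i lti]; first by rewrite psiM tmul_gtable.
  by rewrite (nth_map 0) ?size_iota // nth_iota.
have [[k Ek] _] := ch (pickle (gtable F, fl)).
have [b [D [certD memD]]] := reval_derivable Ek.
move: hq memD {Ek}; case: (h _) => // r _; set q := pickle _ => memD.
have genE (i : nat) : i < 3 -> psi (gen G i) = step_perm n 0 i.
  by move=> lti; rewrite /psi /= /word_coord lti /= mulg1.
pose t := step_perm n 0 0; pose x := step_perm n 0 1; pose y := step_perm n 0 2.
have flE i : i < 3 -> cnth (code fl) i = grank (step_perm n 0 i : F).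
  by move=> lti; rewrite cnthE (nth_map 0) ?size_iota // nth_iota // genE.
(* [m] dominates the witnesses [q], [b], [code D] and [r]. Multiplying it by the order of [x] and
   adding 1 gives a [p] above them all with [x ^ p = x]. *)
pose m := q + b + code D + r + 2.
have leM : m <= #[x]%g * m by rewrite leq_pmull // order_gt0.
exists (#[x]%g * m).+1.
have ltp i : i <= m -> i < (#[x]%g * m).+1 by move=> lei; rewrite ltnS (leq_trans lei).
have lem : [/\ q <= m, b <= m, code D <= m & r <= m].
  split; rewrite /m; first by rewrite -!addnA leq_addr.
  - by rewrite -!addnA addnCA leq_addr.
  - by rewrite -addnA (leq_trans (leq_addl (q + b) _)) ?leq_addr.
  - by rewrite (leq_trans (leq_addl (q + b + code D) _)) ?leq_addr.
split; first by apply: ltp; rewrite /m addn2.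
case: lem => /ltp ltq /ltp ltb /ltp ltD /ltp ltr.
exists q; split=> //; exists b; split=> //; exists (code D); split=> //.
exists r; split=> //; exists (rcode_code c); split; first by rewrite ltnS leq_addr.
have qE : [/\ csize q = 2, cnth q 0 = ctable (gtable F) & cnth q 1 = code fl].
  by rewrite /q pickle_marking csizeE !(cnthE [:: _; _]).
have [-> -> ->] := qE; split=> //; split=> //.
split; first exact/cvalid_tableP/gtable_valid.
rewrite !csizeE size_map size_gtable; split=> //.
split; first by move=> i lti; rewrite flE // grank_lt.
rewrite CodeSeq.codeK; split=> //; split=> //.
rewrite ctmulE !flE // -/t -/x -/y => _ /grankP[e ->].
rewrite tmul_gtable => /grank_inj e1.
have {e1} -> : e = 1%g by apply: (mulgI e); rewrite e1 mulg1.
move=> _ /grankP[u ->]; rewrite !ctpow_gtable !tmul_gtable => /grank_inj tu.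
have {tu} -> : u = (t ^+ (2 ^ n))^-1%g by apply: (mulgI (t ^+ (2 ^ n))%g); rewrite tu mulgV.
split; first by rewrite expgS expgM expg_order expg1n mulg1.
move=> /grank_inj E; apply: (@conj_word_noncomm n).
have nseqE i (s : bool) j : word_perm n 0 (nseq j (i, s)) = (letter_perm n 0 (i, s) ^+ j)%g.
  by elim: j => //= j ->; rewrite expgS.
rewrite word_perm_cat /= !word_perm_cat !nseqE /letter_perm /= !mulg1 -/t -/x -/y.
by rewrite expgVn; apply: E.
Qed.

(** If witnesses exist, [T n] is one and divides itself, against [accepted_not_diagonal]; if none
    exists, [rejected_diagonal] produces one. *)
Lemma not_computed : False.
Proof.
case: (TP n) => [[Tn0 nd]|[dT _]]; last exact: accepted_not_diagonal (dvdnn _) dT.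
by have [p /nd] := rejected_diagonal Tn0.
Qed.

End NotCFQ.

Theorem theorem1 :
  exists G : fgGroup, residually_finite G /\ solvable_WP G /\ ~ CFQ G.
Proof.
have [T TP] := least_diagonal; exists (machineGroup T).
split; first exact: machine_residually_finite.
split.
  apply: machine_solvable_WP; [exact: T_even|exact: T_neq1|exact: recpred_eqmodT].
by move=> [c [h [ch hP]]]; apply: not_computed TP c h ch hP.
Qed.
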